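(* Let $(M,I,J,K)$ be an almost quaternionic manifold with an $IJK$-conical end and let $L_0,L_1\subset M$ be submanifolds, each of which is either compact or $JK$-conical, with compact intersection $L_0\cap L_1$. There exists a compact subset $M_0\subset M$ with the following property: if $U\colon[0,1]\times\mathbb{R}^2\to M$ is a Fueter strip with boundary on $L_0$ and $L_1$, then the image of $U$ is contained in $M_0$.
   Context: An almost quaternionic manifold is a manifold with almost complex structures $I,J,K$ satisfying $IJ=K$. Coordinates on $\mathbb{R}^3\supset[0,1]\times\mathbb{R}^2$ are $(\tau,s,t)$. For $\rho\colon M\to\mathbb{R}$ let $\sigma^I_\rho=-d(d\rho\circ I)$, $\sigma^J_\rho=-d(d\rho\circ J)$, $\sigma^K_\rho=-d(d\rho\circ K)$, and let $\sigma_\rho=\sigma^I_\rho\wedge d\tau+\sigma^J_\rho\wedge ds+\sigma^K_\rho\wedge dt$, a three-form on $\mathbb{R}^3\times M$. A linear map $A\colon\mathbb{R}^3\to T_xM$ is quaternion-antilinear if $IA\partial_\tau+JA\partial_s+KA\partial_t=0$. The function $\rho$ is $IJK$-convex if for every $x$ and every non-zero quaternion-antilinear $A\colon\mathbb{R}^3\to T_xM$, the pull-back $A^*\sigma_\rho$ of $\sigma_\rho$ by the graph map $\mathbb{R}^3\to\mathbb{R}^3\oplus T_xM$ is a negative multiple of $d\tau\wedge ds\wedge dt$. A non-compact $(M,I,J,K)$ has an $IJK$-conical end if there is an exhausting function $\rho\colon M\to\mathbb{R}$ which, outside a compact subset, is $IJK$-convex and has no critical points. A submanifold $L\subset M$ is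 then $JK$-conical if, outside a compact subset, $d\rho$ is non-zero on $TL$ and vanishes on $J(TL)$ and $K(TL)$. Fueter strips are considered for submanifolds $L_0,L_1$ totally real with respect to $J$ and $K$. A Fueter strip with boundary on $L_0,L_1$ is a $C^2$ map $U\colon[0,1]\times\mathbb{R}^2\to M$ with $I(U)\partial_\tau U+J(U)\partial_sU+K(U)\partial_tU=0$, $U(0,s,t)\in L_0$, $U(1,s,t)\in L_1$, $\partial_sU(\tau,\cdot,\cdot)\in L^1(\mathbb{R}^2)\cap L^2(\mathbb{R}^2)$ for all $\tau$, such that there are $p_\pm\in L_0\cap L_1$ and $J$-antiholomorphic strips $u_\pm\colon\mathbb{R}\times[0,1]\to M$, $\partial_tu_\pm-J(u_\pm)\partial_\tau u_\pm=0$, with $u_\pm(t,0)\in L_0$, $u_\pm(t,1)\in L_1$, each converging to $p_-$ as $t\to-\infty$ and to $p_+$ as $t\to+\infty$, with $$\lim_{s\to\pm\infty}U(\tau,s,t)=u_\pm(t,\tau)\text{ in }C^1(\mathbb{R}\times[0,1]),\qquad\lim_{t\to\pm\infty}U(\tau,s,t)=p_\pm\text{ in }C^1_{\mathrm{loc}}([0,1]\times\mathbb{R}).$$ *)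

(* Defs.v *)
From mathcomp Require Import all_boot all_order all_algebra.
From mathcomp Require Import all_classical all_reals all_analysis.

Set Implicit Arguments.
Unset Strict Implicit.
Unset Printing Implicit Defensive.

Import Order.TTheory GRing.Theory Num.Theory.
Import numFieldNormedType.Exports.
Local Open Scope classical_set_scope.
Local Open Scope ring_scope.

(** Differentiability relative to a set.  At a boundary point of [0,1] x R^2
    the derivatives below are the one-sided ones; at an interior point of [A]
    they are the library's [derivable f x v] and ['D_v f x]. *)
Section CalculusOnSets.
Variables (R : realType) (V W : normedModType R).
Implicit Types (A : set V) (f : V -> W) (x v : V).

Definition quotient_within A f x v : set_system W :=
  (fun h : R => h^-1 *: (f (h *: v + x) - f x))
    @ within [set h : R | A (h *: v + x)] (0 : R)^'.

Definition derivable_within A f x v := cvg (quotient_within A f x v).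

Definition derive_within A f x v : W := lim (quotient_within A f x v).

(** [f] is of class C^k on [A]: all iterated directional derivatives relative
    to [A] of order at most [k] exist and are continuous on [A].  Used for open
    subsets of R^n, for [0,1] x R^2, R x [0,1], and for relatively open subsets
    of these. *)
Fixpoint Ck_on (k : nat) A f : Prop :=
  {within A, continuous f} /\
  if k is k'.+1 then
    (forall x v, A x -> derivable_within A f x v) /\
    (forall v, Ck_on k' A (fun x => derive_within A f x v))
  else True.

Definition smooth_on A f := forall k, Ck_on k A f.

End CalculusOnSets.

Section Manifolds.
Variables (R : realType) (n : nat) (M : topologicalType).

Record chart := Chart {
  dom : set M;
  coord : M -> 'cV[R]_n;
  point_of : 'cV[R]_n -> M;
  dom_open : open dom;
  coord_open : open (coord @` dom);
  coordK : forall x, dom x -> point_of (coord x) = x;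
  coord_continuous : {within dom, continuous coord};
  point_of_continuous : {within coord @` dom, continuous point_of} }.

Definition smooth_transition (c c' : chart) :=
  smooth_on (coord c @` (dom c `&` dom c')) (coord c' \o point_of c).

(** The tangent space at [x] is ['cV[R]_n], a tangent vector being given by its
    components in the preferred chart [chart_at x]. *)
Record manifold := Manifold {
  manifold_hausdorff : hausdorff_space M;
  manifold_countable : @second_countable M;
  atlas : set chart;
  atlas_smooth : forall c c', atlas c -> atlas c' -> smooth_transition c c';
  chart_at : M -> chart;
  chart_at_atlas : forall x, atlas (chart_at x);
  chart_at_dom : forall x, dom (chart_at x) x }.

(** From components in the chart [c] to components in the chart [c'] of a
    tangent vector at [x]. *)
Definition coord_change (c c' : chart) (x : M) (v : 'cV[R]_n) : 'cV[R]_n :=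
  'D_v (coord c' \o point_of c) (coord c x).

Variable X : manifold.

Definition smooth_function (rho : M -> R) :=
  forall c, atlas X c -> smooth_on (coord c @` dom c) (rho \o point_of c).

Definition differential (rho : M -> R) (x : M) (v : 'cV[R]_n) : R :=
  'D_v (rho \o point_of (chart_at X x)) (coord (chart_at X x) x).

(** A section of End(TM): [I x] is the matrix of an endomorphism of the tangent
    space at [x]. *)
Definition smooth_endomorphism (I : M -> 'M[R]_n) :=
  forall c, atlas X c -> forall v : 'cV[R]_n,
    smooth_on (coord c @` dom c)
      (fun y => let x := point_of c y in
         coord_change (chart_at X x) c x
           (I x *m coord_change c (chart_at X x) x v)).

Definition almost_complex (I : M -> 'M[R]_n) :=
  smooth_endomorphism I /\ forall x, I x *m I x = - 1%:M.

Definition almost_quaternionic (I J K : M -> 'M[R]_n) :=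
  [/\ almost_complex I, almost_complex J, almost_complex K &
      forall x, I x *m J x = K x].

Definition metric_norm (g : M -> 'M[R]_n) (x : M) (v : 'cV[R]_n) : R :=
  Num.sqrt ((v^T *m g x *m v) ord0 ord0).

Definition riemannian_metric (g : M -> 'M[R]_n) :=
  [/\ forall x, (g x)^T = g x,
      forall x (v : 'cV[R]_n), v != 0 -> 0 < (v^T *m g x *m v) ord0 ord0 &
      forall c, atlas X c -> forall v w : 'cV[R]_n,
        smooth_on (coord c @` dom c)
          (fun y => let x := point_of c y in
             ((coord_change c (chart_at X x) x v)^T *m g x *m
                coord_change c (chart_at X x) x w) ord0 ord0)].

Definition one_form := M -> 'cV[R]_n -> R.
Definition two_form := M -> 'cV[R]_n -> 'cV[R]_n -> R.

(** Component of a one-form on the coordinate vector field [v] of [c]. *)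
Definition form_in_chart (c : chart) (alpha : one_form) (v y : 'cV[R]_n) : R :=
  let x := point_of c y in alpha x (coord_change c (chart_at X x) x v).

Definition ext_deriv (alpha : one_form) : two_form := fun x v w =>
  let c := chart_at X x in
  'D_v (form_in_chart c alpha w) (coord c x)
  - 'D_w (form_in_chart c alpha v) (coord c x).

Definition sigma_of (rho : M -> R) (I : M -> 'M[R]_n) : two_form := fun x v w =>
  - ext_deriv (fun y u => differential rho y (I y *m u)) x v w.

Section MapsToManifold.
Variables (V : normedModType R) (D : set V).

Definition Ck_map (k : nat) (F : V -> M) :=
  {within D, continuous F} /\
  forall c, atlas X c -> Ck_on k (D `&` F @^-1` dom c) (coord c \o F).

(** Derivative of [F] at [p] in the direction [v], a tangent vector at [F p]. *)
Definition map_derive (F : V -> M) (p v : V) : 'cV[R]_n :=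
  derive_within D (coord (chart_at X (F p)) \o F) p v.

End MapsToManifold.

(** T_x L as the set of velocities of C^1 curves in [L]; for an embedded
    submanifold it is the usual tangent space. *)
Definition tangent (L : set M) (x : M) (v : 'cV[R]_n) :=
  exists gamma : R -> M,
    [/\ Ck_map setT 1 gamma, forall t, L (gamma t), gamma 0 = x &
        map_derive setT gamma 0 1 = v].

Definition compatible_chart (c : chart) :=
  forall c', atlas X c' -> smooth_transition c c' /\ smooth_transition c' c.

(** Embedded submanifolds, not necessarily closed. *)
Definition submanifold (L : set M) :=
  exists2 k : nat, (k <= n)%N &
    forall x, L x -> exists c, [/\ compatible_chart c, dom c x &
      forall y, dom c y ->
        (L y <-> forall i : 'I_n, (k <= i)%N -> coord c y i ord0 = 0)].

(** No half-dimensionality is required. *)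
Definition totally_real (J : M -> 'M[R]_n) (L : set M) :=
  forall x v, L x -> tangent L x v -> tangent L x (J x *m v) -> v = 0.

End Manifolds.

(** R^3 with coordinates (tau, s, t), and exterior products normalised by
    (dx /\ dy)(v, w) = dx v * dy w - dx w * dy v. *)
Section Space.
Variable R : realType.

Definition e_tau : R * R * R := (1, 0, 0).
Definition e_s : R * R * R := (0, 1, 0).
Definition e_t : R * R * R := (0, 0, 1).

Definition d_tau (a : R * R * R) : R := a.1.1.
Definition d_s (a : R * R * R) : R := a.1.2.
Definition d_t (a : R * R * R) : R := a.2.

Definition wedge11 (E : Type) (a b : E -> R) (u v : E) : R :=
  a u * b v - a v * b u.

Definition wedge21 (E : Type) (a : E -> E -> R) (b : E -> R) (u v w : E) : R :=
  a u v * b w + a v w * b u + a w u * b v.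

Definition volume : R * R * R -> R * R * R -> R * R * R -> R :=
  wedge21 (wedge11 d_tau d_s) d_t.

End Space.

Section Convexity.
Variables (R : realType) (n : nat) (M : topologicalType) (X : manifold R n M).
Variables (I J K : M -> 'M[R]_n).

Definition quaternion_antilinear (x : M) (A : R * R * R -> 'cV[R]_n) :=
  I x *m A (e_tau R) + J x *m A (e_s R) + K x *m A (e_t R) = 0.

(** The three-form sigma_rho at points of R^3 x {x}, on R^3 (+) T_x M. *)
Definition sigma_rho (rho : M -> R) (x : M)
    (u v w : (R * R * R) * 'cV[R]_n) : R :=
  let pull_M (s : two_form R n M) (a b : (R * R * R) * 'cV[R]_n) :=
    s x a.2 b.2 in
  wedge21 (pull_M (sigma_of X rho I)) (fun a => d_tau a.1) u v w
  + wedge21 (pull_M (sigma_of X rho J)) (fun a => d_s a.1) u v w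
  + wedge21 (pull_M (sigma_of X rho K)) (fun a => d_t a.1) u v w.

Definition IJK_convex_at (rho : M -> R) (x : M) :=
  forall A : {linear (R * R * R)%type -> 'cV[R]_n},
    (exists a, A a != 0) -> quaternion_antilinear x A ->
    exists2 lambda : R, lambda < 0 &
      forall u v w : R * R * R,
        sigma_rho rho x (u, A u) (v, A v) (w, A w) = lambda * volume u v w.

Definition exhausting (rho : M -> R) :=
  smooth_function X rho /\ forall r : R, compact [set x | rho x <= r].

Definition IJK_conical_end (rho : M -> R) :=
  [/\ ~ compact [set: M], exhausting rho &
      exists2 C : set M, compact C &
        forall x, ~ C x ->
          IJK_convex_at rho x /\ exists v, differential X rho x v != 0].

Definition JK_conical (rho : M -> R) (L : set M) :=
  exists2 C : set M, compact C &
    forall x, L x -> ~ C x ->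
      (exists2 v, tangent X L x v & differential X rho x v != 0) /\
      (forall v, tangent X L x v ->
         differential X rho x (J x *m v) = 0 /\
         differential X rho x (K x *m v) = 0).

End Convexity.

Section FueterStrips.
Variables (R : realType) (n : nat) (M : topologicalType) (X : manifold R n M).
Variables (I J K : M -> 'M[R]_n).

(** C^1-closeness over [B] of maps from [D] to the manifold, measured in the
    chart [c] at the points that [G] sends to [C]. *)
Definition C1_close (D B : set (R * R)) (c : chart R n M) (C : set M) (eps : R)
    (F G : R * R -> M) :=
  forall z, B z -> C (G z) ->
    [/\ dom c (F z),
        `|coord c (F z) - coord c (G z)| < eps &
        forall v, v = (1, 0) \/ v = (0, 1) ->
          `|derive_within D (coord c \o F) z v
            - derive_within D (coord c \o G) z v| < eps].

(** Convergence in C^1, uniform over [B], along a filter of parameters: closeness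
    in every chart over every compact subset of its domain. *)
Definition cvg_C1_over (D B : set (R * R)) (F : R -> R * R -> M)
    (Phi : set_system R) (G : R * R -> M) :=
  forall (c : chart R n M) (C : set M) (eps : R),
    atlas X c -> compact C -> C `<=` dom c -> 0 < eps ->
    \forall r \near Phi, C1_close D B c C eps (F r) G.

Definition cvg_C1 (D : set (R * R)) F Phi G := cvg_C1_over D D F Phi G.

Definition cvg_C1_loc (D : set (R * R)) F Phi G :=
  forall B, compact B -> B `<=` D -> cvg_C1_over D B F Phi G.

Definition strip3 : set (R * R * R) := [set p | 0 <= p.1.1 <= 1].
(** Pairs (t, tau) in R x [0,1]. *)
Definition strip_t_tau : set (R * R) := [set z | 0 <= z.2 <= 1].
(** Pairs (tau, s) in [0,1] x R. *)
Definition strip_tau_s : set (R * R) := [set z | 0 <= z.1 <= 1].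

(** J-antiholomorphic strips u(t, tau) from [p] to [q]; the limits at infinity
    are uniform in tau. *)
Definition antiholomorphic_strip (L0 L1 : set M) (p q : M) (u : R * R -> M) :=
  [/\ Ck_map X strip_t_tau 1 u,
      forall z, strip_t_tau z ->
        map_derive X strip_t_tau u z (1, 0)
        - J (u z) *m map_derive X strip_t_tau u z (0, 1) = 0,
      forall t, L0 (u (t, 0)) /\ L1 (u (t, 1)),
      forall N, nbhs p N ->
        \forall t \near -oo, forall tau, 0 <= tau <= 1 -> N (u (t, tau)) &
      forall N, nbhs q N ->
        \forall t \near +oo, forall tau, 0 <= tau <= 1 -> N (u (t, tau))].

Definition fueter_equation (U : R * R * R -> M) :=
  forall p, strip3 p ->
    I (U p) *m map_derive X strip3 U p (e_tau R)
    + J (U p) *m map_derive X strip3 U p (e_s R)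
    + K (U p) *m map_derive X strip3 U p (e_t R) = 0.

Definition norm_ds (g : M -> 'M[R]_n) (U : R * R * R -> M) (tau : R)
    (z : R * R) : R :=
  let p := (tau, z.1, z.2) in
  metric_norm g (U p) (map_derive X strip3 U p (e_s R)).

(** The asymptotics force the image of [U] to be relatively compact, so the
    integrability condition does not depend on the Riemannian metric. *)
Definition ds_integrable (U : R * R * R -> M) :=
  exists2 g, riemannian_metric X g &
    forall tau, 0 <= tau <= 1 ->
      norm_ds g U tau \in Lfun (lebesgue_measure \x lebesgue_measure)%E 1%E /\
      norm_ds g U tau \in Lfun (lebesgue_measure \x lebesgue_measure)%E 2%:E.

Definition fueter_asymptotics (L0 L1 : set M) (U : R * R * R -> M) :=
  exists pm pp : M, exists um up : R * R -> M,
    [/\ (L0 `&` L1) pm /\ (L0 `&` L1) pp,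
        antiholomorphic_strip L0 L1 pm pp um /\
        antiholomorphic_strip L0 L1 pm pp up,
        cvg_C1 strip_t_tau (fun s z => U (z.2, s, z.1)) -oo um /\
        cvg_C1 strip_t_tau (fun s z => U (z.2, s, z.1)) +oo up &
        cvg_C1_loc strip_tau_s (fun t z => U (z.1, z.2, t)) -oo (fun=> pm) /\
        cvg_C1_loc strip_tau_s (fun t z => U (z.1, z.2, t)) +oo (fun=> pp)].

Definition fueter_strip (L0 L1 : set M) (U : R * R * R -> M) :=
  [/\ Ck_map X strip3 2 U,
      fueter_equation U,
      forall s t, L0 (U (0, s, t)) /\ L1 (U (1, s, t)),
      ds_integrable U &
      fueter_asymptotics L0 L1 U].

End FueterStrips.

(* Main.v *)
Require Import Defs.
From mathcomp Require Import all_boot all_order all_algebra.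
From mathcomp Require Import all_classical all_reals all_analysis.
From HB Require Import structures.
From mathcomp Require Import ring lra.

Import Order.TTheory GRing.Theory Num.Theory.
Import numFieldNormedType.Exports.
(* [vector.coord] of MathComp would otherwise shadow the field [coord] of [chart]. *)
Import Defs.
Local Open Scope classical_set_scope.
Local Open Scope ring_scope.

(** For a Fueter strip [U], the equation and its multiples by [J] and [K] express
    each derivative of [U] through the other two, so the differential of
    [f = rho \o U] is dual, for the flat metric, to
    [a_I /\ d tau + a_J /\ d s + a_K /\ d t], where [a_I] is the pull-back of
    [d rho \o I].  Differentiating once more, the flat Laplacian of [f] equals
    minus the coefficient of [A^* sigma_rho] for [A = dU], hence is nonnegative
    wherever [rho] is IJK-convex.  On the walls [tau = 0, 1] the same relation
    reads [df/dtau = d rho (K d_s U - J d_t U)], which vanishes where the boundary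
    submanifold is JK-conical since [d_s U] and [d_t U] are tangent to it.  Thus,
    above a level [r] bounding [rho] on the exceptional compact sets, [f] is
    subharmonic with Neumann boundary values, and the asymptotic conditions push it
    below [r + e] for large [|t|], while it stays bounded as [|s|] grows.  Adding
    [eps t^2 - del s^2 + eta tau (1 - tau)] with [eps > del + eta] makes an interior
    maximum above the level impossible, so [f <= r] everywhere. *)

(** * Derivatives relative to a set *)

Lemma within_near_eq (T : Type) (F : set_system T) (A B : set T) :
  Filter F -> (\forall h \near F, A h <-> B h) -> within A F = within B F.
Proof.
move=> FF AB; apply/seteqP; split=> P; rewrite /within /nbhs /= => FP.
  by apply: filterS2 AB FP => h [_ BA] AP /BA.
by apply: filterS2 AB FP => h [BA _] AP /BA.
Qed.

Section WithinDerivatives.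
Context {R : realType} {V W : normedModType R}.
Implicit Types (A B : set V) (f g : V -> W) (x v : V).

Lemma near_line x v (P : set V) : nbhs x P -> \forall h \near (0 : R), P (h *: v + x).
Proof.
move=> xP.
have cv : h *: v + x @[h --> (0 : R)] --> x.
  rewrite -[X in _ --> X]add0r -[X in _ --> X + _](scale0r v).
  by apply: cvgD; [apply: cvgZr_tmp; exact: cvg_id|exact: cvg_cst].
exact: cv.
Qed.

Lemma near_line_dnbhs x v (P : set V) :
  nbhs x P -> \forall h \near (0 : R)^', P (h *: v + x).
Proof. by move=> xP; apply: cvg_within; exact: near_line. Qed.

(** A relative derivative depends only on the germ of the set at the point. This allows [D] to be
    exchanged with its part mapped into one chart domain, and with the whole space at interior
    points. *)
Lemma quotient_within_near A B f x v :
  (\forall y \near x, A y <-> B y) ->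
  quotient_within A f x v = quotient_within B f x v.
Proof.
move=> AB; rewrite /quotient_within; congr (_ @ _); apply: within_near_eq.
exact: (@near_line_dnbhs x v [set y | A y <-> B y]).
Qed.

Lemma quotient_within_interior A f x v : nbhs x A ->
  quotient_within A f x v = ((fun h => h^-1 *: ((f \o shift x) (h *: v) - f x)) @ 0^').
Proof.
move=> xA; rewrite (@quotient_within_near A setT); last first.
  by apply: filterS xA.
rewrite /quotient_within; congr (_ @ _).
apply/seteqP; split=> P; rewrite /within /nbhs /=; apply: filterS => h.
  by apply.
by [].
Qed.

Lemma derive_within_interior A f x v : nbhs x A ->
  derive_within A f x v = 'D_v f x.
Proof. by move=> /quotient_within_interior xA; rewrite /derive_within xA. Qed.

Lemma derivable_within_interior A f x v : nbhs x A ->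
  derivable_within A f x v = derivable f x v.
Proof. by move=> /quotient_within_interior xA; rewrite /derivable_within xA. Qed.

Lemma quotient_within_eq A f g x v : {in A, f =1 g} -> A x ->
  quotient_within A f x v = quotient_within A g x v.
Proof.
move=> fg Ax; rewrite /quotient_within.
have H : (\forall h \near within [set h : R | A (h *: v + x)] (0 : R)^',
   h^-1 *: (f (h *: v + x) - f x) = h^-1 *: (g (h *: v + x) - g x)).
  by apply: filterS (withinT _ _) => h /= Ah; rewrite fg ?inE// fg ?inE.
apply/seteqP; split; apply: near_eq_cvg; first exact: H.
by apply: filterS H => h.
Qed.

Lemma derive_within_eq A f g x v : {in A, f =1 g} -> A x ->
  derive_within A f x v = derive_within A g x v.
Proof. by move=> fg Ax; rewrite /derive_within (quotient_within_eq _ _ g). Qed.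

Lemma derivable_within_eq A f g x v : {in A, f =1 g} -> A x ->
  derivable_within A f x v = derivable_within A g x v.
Proof. by move=> fg Ax; rewrite /derivable_within (quotient_within_eq _ _ g). Qed.

End WithinDerivatives.

(** * Functions of class C^k on a set and on its open subsets *)

Section CkOn.
Context {R : realType} {V W : normedModType R}.
Implicit Types (A O : set V).

Lemma Ck_on_eq k A (f g : V -> W) : {in A, f =1 g} -> Ck_on k A f -> Ck_on k A g.
Proof.
elim: k f g => [|k IHk] f g fg /= [cf Hf]; split=> //.
- exact: subspace_eq_continuous cf.
- exact: subspace_eq_continuous cf.
have {}fg' := fg; split=> [x v Ax|v].
  by rewrite -(derivable_within_eq A f)//; apply: Hf.1.
apply: IHk (Hf.2 v) => x; rewrite inE => Ax.
exact: derive_within_eq.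
Qed.

Lemma Ck_onS k A (f : V -> W) : Ck_on k.+1 A f -> Ck_on k A f.
Proof.
elim: k f => [|k IHk] f [cf [df Df]]; split=> //; split=> // v.
exact: IHk (Df v).
Qed.

Lemma Ck_on_continuous k O (f : V -> W) x :
  open O -> Ck_on k O f -> O x -> {for x, continuous f}.
Proof.
move=> oO; case: k => [|k] [cf _] Ox; move: cf;
  by rewrite continuous_open_subspace// => /(_ x); apply; rewrite inE.
Qed.

Lemma Ck_on_open k A O (f : V -> W) :
  open O -> O `<=` A -> Ck_on k A f -> Ck_on k O f.
Proof.
move=> oO OA; have nA x : O x -> nbhs x A.
  by move=> Ox; apply: filterS OA _; exact: open_nbhs_nbhs.
have nO x : O x -> nbhs x O by move=> Ox; exact: open_nbhs_nbhs.
elim: k f => [|k IHk] f /= [cf Hf]; split=> //; try exact: continuous_subspaceW cf.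
split=> [x v Ox|v].
  rewrite derivable_within_interior; last exact: nO.
  by rewrite -(derivable_within_interior A)//; [apply: Hf.1; exact: OA|exact: nA].
apply: Ck_on_eq (IHk _ (Hf.2 v)) => x; rewrite inE => Ox.
by rewrite !derive_within_interior//; [exact: nO|exact: nA].
Qed.

Lemma Ck_on_derivable k O (f : V -> W) x v :
  open O -> Ck_on k.+1 O f -> O x -> derivable f x v.
Proof.
move=> oO [_ [H _]] Ox; rewrite -(derivable_within_interior O); first exact: H.
exact: open_nbhs_nbhs.
Qed.

Lemma Ck_on_derive k O (f : V -> W) v :
  open O -> Ck_on k.+1 O f -> Ck_on k O ('D_v f).
Proof.
move=> oO [_ [_ H]]; apply: Ck_on_eq (H v) => x; rewrite inE => Ox.
by rewrite derive_within_interior//; exact: open_nbhs_nbhs.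
Qed.

End CkOn.

(** * Continuously differentiable functions *)

Section DirectionalCalculus.
Context {R : realType} {V : normedModType R}.
Implicit Types (x y v w : V).

Lemma is_derive_line {W : normedModType R} (f : V -> W) y v (t : R) :
  derivable f (t *: v + y) v ->
  is_derive t 1 (fun t => f (t *: v + y)) ('D_v f (t *: v + y)).
Proof.
have E : (fun h : R => h^-1 *: (f ((h%:A + t) *: v + y) - f (t *: v + y))) =
  (fun h : R => h^-1 *: (f (h *: v + (t *: v + y)) - f (t *: v + y))).
  by apply/funext => h; rewrite [h%:A]mulr1 scalerDl addrA.
move=> df; split; first by rewrite /derivable /= E.
by rewrite /derive /= E.
Qed.

Lemma mean_value_dir (f : V -> R) y v :
  (forall t : R, 0 <= t <= 1 -> derivable f (t *: v + y) v) ->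
  exists2 c, 0 <= c <= 1 & f (v + y) - f y = 'D_v f (c *: v + y).
Proof.
move=> df; pose g (t : R) := f (t *: v + y).
have dg (t : R) : t \in `[0, 1]%R -> is_derive t 1 g ('D_v f (t *: v + y)).
  by rewrite in_itv /= => /df /is_derive_line.
have dg' (t : R) : t \in `]0, 1[%R -> is_derive t 1 g ('D_v f (t *: v + y)).
  by move=> t01; apply: dg; exact: subset_itv_oo_cc.
have cg : {within `[0, 1], continuous g}.
  by apply: derivable_within_continuous => t /dg /@ex_derive.
have [c c01] := MVT_segment ler01 dg' cg.
rewrite /g scale1r scale0r add0r subr0 mulr1 => E.
by exists c.
Qed.

(** Derivability along [v] alone suffices: restricted to the line, [f] is a function of one real
    variable, for which derivable means differentiable, and its differential is linear. The case
    [a = 0] is included. *)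
Lemma derivable_scaled {W : normedModType R} (f : V -> W) x v (a : R) :
  derivable f x v -> is_derive x (a *: v) f (a *: 'D_v f x).
Proof.
move=> df; have df0 : derivable f (0 *: v + x) v by rewrite scale0r add0r.
have := is_derive_line _ _ _ _ df0.
set g := fun t => _ => -[dg Dg].
have dg' : differentiable g 0 by apply/derivable1_diffP.
have E : (fun h : R => h^-1 *: (g (h *: a + 0) - g 0)) =
  (fun h : R => h^-1 *: (f (h *: (a *: v) + x) - f x)).
  by apply/funext => h; rewrite /g addr0 scalerA scale0r add0r.
have H : 'D_a g 0 = a *: 'D_v f x.
  rewrite deriveE// -[in LHS](mulr1 a) -[a * 1]/(a *: 1) linearZ /= -deriveE// Dg.
  by rewrite scale0r add0r.
split; last by rewrite -H /derive /= E.
by have := @diff_derivable _ _ _ _ _ a dg'; rewrite /derivable /= E.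
Qed.

End DirectionalCalculus.

Section MatrixNorm.
Context {R : realType} {m n : nat}.
Implicit Types M : 'M[R]_(m, n).

Lemma mx_norm_coord M i j : `|M i j| <= `|M|.
Proof.
by rewrite [leRHS]/Num.Def.normr/= mx_normrE; exact: (le_bigmax _ _ (i, j)).
Qed.

Lemma mx_norm_le M e : 0 <= e -> (forall i j, `|M i j| <= e) -> `|M| <= e.
Proof.
move=> e0 H; rewrite [leLHS]/Num.Def.normr/= mx_normrE.
by rewrite bigmax_le//= => -[i j] _; exact: H.
Qed.

End MatrixNorm.

Section LinearCombination.
Context {R : realType} {n : nat} {W : normedModType R}.

(** The linear map with values [c i] on the standard basis; with partial derivatives for [c] it is
    the candidate differential. *)
Definition lincomb (c : 'I_n -> W) (h : 'cV[R]_n) : W := \sum_i h i ord0 *: c i.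

Lemma lincomb_is_linear c : linear (lincomb c).
Proof.
move=> a u v; rewrite /lincomb scaler_sumr -big_split /=; apply: eq_bigr => i _.
by rewrite !mxE scalerDl scalerA.
Qed.

HB.instance Definition _ c :=
  GRing.isLinear.Build R 'cV[R]_n W *:%R (lincomb c) (lincomb_is_linear c).

Lemma lincomb_continuous c : continuous (lincomb c).
Proof.
move=> x; rewrite (_ : lincomb c = \sum_i (fun h : 'cV[R]_n => h i ord0 *: c i)).
  apply: differentiable_continuous; apply: differentiable_sum => i.
  by apply: differentiableZl; exact: differentiable_coord.
by apply/funext => h; rewrite fct_sumE.
Qed.

Lemma linear_lincomb (f : {linear 'cV[R]_n -> W}) v :
  f v = \sum_i v i ord0 *: f (delta_mx i ord0).
Proof.
rewrite [in LHS](matrix_sum_delta v) linear_sum; apply: eq_bigr => i _.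
by rewrite big_ord1 linearZ.
Qed.

End LinearCombination.

Lemma differentiable_eps {R : realType} {V W : normedModType R} (f : V -> W)
    (L : {linear V -> W}) x :
  continuous L ->
  (forall e, 0 < e -> \forall h \near (0 : V), `|f (h + x) - f x - L h| <= e * `|h|) ->
  differentiable f x.
Proof.
move=> cL H.
suff E : f \o shift x = cst (f x) + L +o_ 0 id.
  by apply/diff_locallyP; rewrite (diff_unique cL E).
apply/eqaddoP => _/posnumP[e].
by apply: filterS (H e%:num _) => // h; rewrite /= opprD addrA.
Qed.

Section Coordinates.
Context {R : realType} {V : normedModType R} {m n : nat}.
Implicit Types (f : V -> 'M[R]_(m, n)).

Lemma cvg_mx_coord (T : Type) (F : set_system T) {FF : Filter F}
    (g : T -> 'M[R]_(m, n)) (l : 'M[R]_(m, n)) i j :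
  g t @[t --> F] --> l -> g t i j @[t --> F] --> l i j.
Proof.
move=> gl; apply/cvgrPdist_le => e e0; move/cvgrPdist_le: gl => /(_ _ e0).
by apply: filterS => t; apply: le_trans; have := mx_norm_coord (l - g t) i j; rewrite !mxE.
Qed.

Lemma Ck_on_coord k (O : set V) f i j :
  open O -> Ck_on k O f -> Ck_on k O (fun x => f x i j).
Proof.
move=> oO; elim: k f => [|k IHk] f /= [cf Hf].
  by split=> // x; exact: (@cvg_mx_coord (subspace O) (nbhs x) _ _ _ _ _ (cf x)).
have nO x : O x -> nbhs x O by move=> Ox; exact: open_nbhs_nbhs.
have df x v : O x -> derivable f x v.
  by move=> Ox; rewrite -(derivable_within_interior O); [exact: Hf.1|exact: nO].
split; first by move=> x; exact: (@cvg_mx_coord (subspace O) (nbhs x) _ _ _ _ _ (cf x)).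
split=> [x v Ox|v].
  by rewrite derivable_within_interior; [exact: (derivable_mxP _ _ _).1 (df _ v Ox) i j|exact: nO].
apply: Ck_on_eq (IHk _ (Hf.2 v)) => x; rewrite inE => Ox.
rewrite !derive_within_interior; [|exact: nO|exact: nO].
by rewrite derive_mx ?mxE//; exact: df.
Qed.

End Coordinates.

Section ContinuouslyDifferentiable.
Context {R : realType} {n : nat}.

(** The point [x] is joined to [h + x] by changing one coordinate at a time. The mean value theorem
    on each leg produces a partial derivative at a nearby point, and continuity of the partial
    derivatives makes the error small relative to [h]. *)
Lemma C1_differentiable_scalar (O : set 'cV[R]_n) (f : 'cV[R]_n -> R) x :
  open O -> Ck_on 1 O f -> O x -> differentiable f x.
Proof.
move=> oO C1 Ox; pose E (i : 'I_n) : 'cV[R]_n := delta_mx i ord0.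
apply: (@differentiable_eps _ _ _ _ (lincomb (fun i => 'D_(E i) f x)) _ (lincomb_continuous _)).
move=> _/posnumP[e].
(* The [n] legs contribute at most [e'] times the norm of [h] each; dividing by [n.+1] also covers
   [n = 0]. *)
pose e' := e%:num / n.+1%:R.
have e'0 : 0 < e' by rewrite divr_gt0.
have nearD : \forall y \near x, O y /\ forall i : 'I_n, `|'D_(E i) f x - 'D_(E i) f y| <= e'.
  apply: filterI; first exact: open_nbhs_nbhs.
  refine (@filter_forall _ _ (fun i y => `|'D_(E i) f x - 'D_(E i) f y| <= e')
    _ (nbhs_filter x) _) => i.
  have /cvgrPdist_le := Ck_on_continuous _ _ _ _ oO (Ck_on_derive _ _ _ (E i) oO C1) Ox.
  by move=> /(_ _ e'0).
have /nbhs_ballP[d d0 Hd] := nearD.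
near=> h => /=.
have {Hd}hd y : `|y| <= `|h| ->
    O (y + x) /\ forall i : 'I_n, `|'D_(E i) f x - 'D_(E i) f (y + x)| <= e'.
  move=> yh; apply: Hd; rewrite -ball_normE /= opprD addrCA subrr addr0 normrN.
  apply: le_lt_trans yh _; near: h; exact: (@nbhs0_lt R 'cV[R]_n d d0).
(* [P k] keeps the first [k] coordinates of [h], so [P 0 = 0] and [P n = h]. In the maximum norm all
   points of the legs stay within the norm of [h], where [hd] applies. *)
pose P k : 'cV[R]_n := \col_i (if (i < k)%N then h i ord0 else 0).
have step (i : 'I_n) : `|f (P i.+1 + x) - f (P i + x) - h i ord0 * 'D_(E i) f x| <= e' * `|h|.
  have EP : P i.+1 = h i ord0 *: E i + P i.
    apply/colP => j; rewrite !mxE eqxx andbT ltnS.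
    have [->|ji] := eqVneq j i; first by rewrite leqnn ltnn mulr1 addr0.
    by rewrite leq_eqVlt (negbTE (ji : (j : nat) != i)) mulr0 add0r.
  have HP (t : R) : 0 <= t <= 1 -> `|t *: (h i ord0 *: E i) + P i| <= `|h|.
    move=> /andP[t0 t1]; apply: mx_norm_le => // j k; rewrite !mxE.
    rewrite (ord1 k) eqxx andbT; have [->|ji] := eqVneq j i.
      rewrite ltnn mulr1 addr0 normrM (ger0_norm t0).
      apply: le_trans (mx_norm_coord h i ord0).
      by rewrite ler_piMl.
    rewrite !mulr0 add0r; case: ifP => _; first exact: mx_norm_coord.
    by rewrite normr0.
  have dE y : O y -> derivable f y (E i) by move=> Oy; exact: Ck_on_derivable C1 Oy.
  rewrite EP -(addrA _ (P i)).
  have [|c c01 ->] := mean_value_dir f (P i + x) (h i ord0 *: E i).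
    move=> t t01; rewrite addrA; apply: (@ex_derive _ _ _ _ _ _ _ (derivable_scaled _ _ _ _ _)).
    by apply: dE; apply: (hd _ (HP _ t01)).1.
  have [Oc Hc] := hd _ (HP _ c01).
  have := derivable_scaled f _ (E i) (h i ord0) (dE _ Oc).
  rewrite -addrA => /@derive_val ->.
  rewrite -[h i ord0 *: 'D_(E i) f _]/(h i ord0 * 'D_(E i) f _) -mulrBr normrM mulrC ler_pM//.
    by rewrite distrC addrA.
  exact: mx_norm_coord.
have tel : f (h + x) - f x = \sum_(i < n) (f (P i.+1 + x) - f (P i + x)).
  rewrite -(big_mkord xpredT (fun i => f (P i.+1 + x) - f (P i + x)))
    (telescope_sumr (fun k => f (P k + x)))//.
  congr (f (_ + _) - f _); first by apply/colP => j; rewrite mxE ltn_ord.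
  by rewrite -[LHS]add0r; congr (_ + _); apply/colP => j; rewrite !mxE.
rewrite [X in `|X|](_ : _ =
    \sum_(i < n) (f (P i.+1 + x) - f (P i + x) - h i ord0 * 'D_(E i) f x)); last first.
  by rewrite sumrB -tel.
apply: le_trans (ler_norm_sum _ _ _) _.
apply: le_trans (ler_sum _ (fun i _ => step i)) _.
rewrite sumr_const card_ord -mulr_natl /e' mulrA ler_wpM2r//.
rewrite mulrCA ler_piMr// ler_pdivrMr// mul1r ler_nat//.
Unshelve. all: by end_near. Qed.

Lemma C1_differentiable {m : nat} (O : set 'cV[R]_n) (f : 'cV[R]_n -> 'cV[R]_m) x :
  open O -> Ck_on 1 O f -> O x -> differentiable f x.
Proof.
move=> oO C1 Ox.
have fE : f = \sum_(i < m) (fun y => f y i ord0 *: (delta_mx i ord0 : 'cV[R]_m)).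
  apply/funext => y; rewrite fct_sumE [LHS]matrix_sum_delta.
  by apply: eq_bigr => i _; rewrite big_ord1.
rewrite fE; apply: differentiable_sum => i; apply: differentiableZl.
apply: (C1_differentiable_scalar _ _ _ oO _ Ox).
exact: (Ck_on_coord 1).
Qed.

End ContinuouslyDifferentiable.

(** * Second differences, towards the symmetry of mixed derivatives *)

Section Schwarz.
Context {R : realType} {V : normedModType R}.

(** Two mean value theorems: first along [v] for the increment [f (w + y) - f y] as a function of
    [y], then along [w] for ['D_v f]. *)
Lemma second_difference (f : V -> R) x v w :
  (forall s t : R, 0 <= s <= 1 -> 0 <= t <= 1 -> derivable f (s *: v + (t *: w + x)) v) ->
  (forall s t : R, 0 <= s <= 1 -> 0 <= t <= 1 ->
     derivable ('D_v f) (s *: v + (t *: w + x)) w) ->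
  exists s t : R, [/\ 0 <= s <= 1, 0 <= t <= 1 &
    f (v + (w + x)) - f (v + x) - (f (w + x) - f x) =
    'D_w ('D_v f) (s *: v + (t *: w + x))].
Proof.
move=> d1 d2.
have d1w s : 0 <= s <= 1 -> derivable f (s *: v + (w + x)) v.
  by move=> s01; have := d1 s 1 s01; rewrite scale1r; apply; rewrite ler01 lexx.
have d10 s : 0 <= s <= 1 -> derivable f (s *: v + x) v.
  by move=> s01; have := d1 s 0 s01; rewrite scale0r add0r; apply; rewrite ler01 lexx.
pose g y := f (w + y) - f y.
have dg s : 0 <= s <= 1 ->
    is_derive (s *: v + x) v g ('D_v f (s *: v + (w + x)) - 'D_v f (s *: v + x)).
  move=> s01; apply: is_deriveB; last exact/derivableP/d10.
  have E : (fun h : R => h^-1 *: (f (w + (h *: v + (s *: v + x))) - f (w + (s *: v + x)))) =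
     (fun h : R => h^-1 *: (f (h *: v + (s *: v + (w + x))) - f (s *: v + (w + x)))).
    apply/funext => h; rewrite (addrCA w (s *: v)); congr (_ *: (f _ - _)).
    by rewrite addrCA (addrCA w).
  have := d1w _ s01; split; first by rewrite /derivable /= E.
  by rewrite /derive /= E.
have [|s s01 Es] := mean_value_dir g x v.
  by move=> s s01; exact: (@ex_derive _ _ _ _ _ _ _ (dg _ s01)).
have [|t t01 Et] := mean_value_dir ('D_v f) (s *: v + x) w.
  by move=> t t01; rewrite addrCA; exact: d2.
exists s, t; split=> //.
rewrite (addrCA _ (t *: w)) -Et (addrCA w (s *: v)).
rewrite -(@derive_val _ _ _ _ _ _ _ (dg _ s01)) -Es /g addrCA (addrC w x).
by [].
Qed.

End Schwarz.

(** * Second derivatives *)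

Lemma is_derive_quadratic {R : realType} (a b h : R) :
  is_derive h 1 (fun h : R => a * h ^+ 2 + b * h) (a * (2 * h) + b).
Proof.
rewrite [X in is_derive _ _ X _](_ : _ = (a \*: (@idfun R) ^+ 2 + b \*: (@idfun R))); last first.
  by apply/funext => y.
apply: is_derive_eq => /=.
rewrite /GRing.scale/=; ring.
Qed.
Lemma is_derive_affine {R : realType} (a b h : R) :
  is_derive h 1 (fun h : R => a * h + b) a.
Proof.
rewrite [X in is_derive _ _ X _](_ : _ = (a \*: (@idfun R) + cst b)); last first.
  by apply/funext => y.
apply: is_derive_eq => /=.
rewrite /GRing.scale/=; ring.
Qed.

Section SecondOrder.
Context {R : realType} {V : normedModType R}.

(** The second difference over a small parallelogram does not depend on the order of its sides. It
    equals [h ^+ 2] times either mixed derivative, each at some point of the parallelogram, and both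
    are continuous at [x]. *)
Lemma schwarz_scalar (O : set V) (f : V -> R) x v w :
  open O -> Ck_on 2 O f -> O x -> 'D_w ('D_v f) x = 'D_v ('D_w f) x.
Proof.
move=> oO C2 Ox.
have C1 : Ck_on 1 O f := Ck_onS _ _ _ C2.
have C1D u : Ck_on 1 O ('D_u f) := Ck_on_derive _ _ _ u oO C2.
apply/eqP; rewrite -subr_eq0 -normr_le0; apply/ler_addgt0Pr => /= e e0; rewrite add0r.
have e20 : 0 < e / 2 by rewrite divr_gt0.
have near2 u1 u2 : \forall y \near x, `|'D_u2 ('D_u1 f) x - 'D_u2 ('D_u1 f) y| <= e / 2.
  have /cvgrPdist_le := Ck_on_continuous _ _ _ _ oO (Ck_on_derive _ _ _ u2 oO (C1D u1)) Ox.
  by move=> /(_ _ e20).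
have : \forall y \near x, [/\ O y, `|'D_w ('D_v f) x - 'D_w ('D_v f) y| <= e / 2 &
    `|'D_v ('D_w f) x - 'D_v ('D_w f) y| <= e / 2].
  by apply: filterS3 (open_nbhs_nbhs (conj oO Ox)) (near2 v w) (near2 w v) => y; split.
move=> /nbhs_ballP[d d0 Hd].
(* The scale [h] puts the parallelogram with sides [h *: v] and [h *: w] inside the ball of radius
   [d]; the added 1 in the denominator allows [v = w = 0]. *)
have [h h0 hd] : exists2 h : R, 0 < h & h * (`|v| + `|w|) < d.
  have vw0 : 0 < `|v| + `|w| + 1 by rewrite ltr_wpDl// addr_ge0.
  exists (d / 2 / (`|v| + `|w| + 1)); first by rewrite !divr_gt0.
  rewrite mulrAC ltr_pdivrMr//.
  have : 0 <= d * (`|v| + `|w|) by rewrite mulr_ge0 ?addr_ge0// ltW.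
  by move: d0 => /=; lra.
have Hsm (s t : R) (v' w' : V) : `|v'| + `|w'| = `|v| + `|w| -> 0 <= s <= 1 -> 0 <= t <= 1 ->
    ball x d (s *: (h *: v') + (t *: (h *: w') + x)).
  move=> vw' /andP[s0 s1] /andP[t0 t1]; rewrite -ball_normE /= addrA opprD.
  rewrite addrCA subrr addr0 normrN.
  apply: le_lt_trans (ler_normD _ _) _; rewrite !normrZ (ger0_norm s0) (ger0_norm t0).
  rewrite (gtr0_norm h0).
  apply: le_lt_trans hd; rewrite -vw' mulrDr lerD// ler_piMl// mulr_ge0// ltW//.
(* The hypothesis on norms is symmetric, so this serves for both orders of [v] and [w]. *)
have diff2 (v' w' : V) : `|v'| + `|w'| = `|v| + `|w| -> exists s t : R,
    [/\ 0 <= s <= 1, 0 <= t <= 1 &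
      f (h *: v' + (h *: w' + x)) - f (h *: v' + x) - (f (h *: w' + x) - f x)
      = h *: (h *: 'D_w' ('D_v' f) (s *: (h *: v') + (t *: (h *: w') + x)))].
  move=> vw'.
  have Dh y : O y -> 'D_(h *: v') f y = h *: 'D_v' f y.
    by move=> Oy; apply: (@derive_val _ _ _ _ _ _ _ (derivable_scaled _ _ _ _ _));
      exact: Ck_on_derivable C1 Oy.
  have nDh y : O y -> \forall z \near y, 'D_(h *: v') f z = (h \*: 'D_v' f) z.
    by move=> Oy; apply: filterS (open_nbhs_nbhs (conj oO Oy)) => z /Dh.
  have dDh y : O y -> is_derive y (h *: w') ('D_(h *: v') f) (h *: (h *: 'D_w' ('D_v' f) y)).
    move=> Oy; apply: (@near_eq_is_derive _ _ _ (h \*: 'D_v' f)).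
      by apply: filterS (nDh _ Oy) => z.
    have dv := Ck_on_derivable 0 _ _ _ w' oO (C1D v') Oy.
    have [d1 D1] := derivable_scaled _ _ _ h dv.
    split; first exact: derivableZ.
    by rewrite (deriveZ _ d1) D1.
  have [s t s01 t01|s t s01 t01|s [t [s01 t01 ->]]] := second_difference f x (h *: v') (h *: w').
  - apply: (@ex_derive _ _ _ _ _ _ _ (derivable_scaled _ _ _ _ _)).
    by apply: Ck_on_derivable C1 _; have [] := Hd _ (Hsm s t _ _ vw' s01 t01).
  - apply: (@ex_derive _ _ _ _ _ _ _ (dDh _ _)).
    by have [] := Hd _ (Hsm s t _ _ vw' s01 t01).
  exists s, t; split=> //; apply: (@derive_val _ _ _ _ _ _ _ (dDh _ _)).
  by have [] := Hd _ (Hsm s t _ _ vw' s01 t01).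
have [s [t [s01 t01 E1]]] := diff2 v w erefl.
have [s' [t' [s01' t01' E2]]] := diff2 w v (addrC _ _).
have [_ H1 _] := Hd _ (Hsm s t v w erefl s01 t01).
have [_ _ H2] := Hd _ (Hsm s' t' w v (addrC _ _) s01' t01').
have EE : 'D_w ('D_v f) (s *: (h *: v) + (t *: (h *: w) + x)) =
   'D_v ('D_w f) (s' *: (h *: w) + (t' *: (h *: v) + x)).
  have h0' : h != 0 by rewrite gt_eqF.
  have sub4 (A B C D : R) : A - B - (C - D) = A - C - (B - D) by ring.
  have cancel2 (A B : R) : h *: (h *: A) = h *: (h *: B) -> A = B.
    by move=> /(mulfI h0') /(mulfI h0').
  apply: cancel2; refine (etrans (esym E1) (etrans _ E2)).
  by rewrite sub4 [X in f X]addrCA.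
rewrite EE in H1; rewrite distrC in H2.
by apply: le_trans (ler_distD _ _ _) _; rewrite [e]splitr; exact: lerD H1 H2.
Qed.

Lemma second_derivative_le (f : V -> R) x v (a b : R) :
  (\forall y \near x, derivable f y v) -> derivable ('D_v f) x v ->
  (\forall h \near (0 : R), f (h *: v + x) + a * h ^+ 2 + b * h <= f x) ->
  'D_v ('D_v f) x <= - 2 * a.
Proof.
move=> df d2f fmax.
pose g (h : R) := f (h *: v + x) + (a * h ^+ 2 + b * h).
pose G (h : R) := 'D_v f (h *: v + x) + (a * (2 * h) + b).
have dg (h : R) : derivable f (h *: v + x) v -> is_derive h 1 g (G h).
  move=> /is_derive_line dfh; rewrite /g /G.
  by apply: is_deriveD; exact: is_derive_quadratic.
have dG : is_derive (0 : R) 1 G ('D_v ('D_v f) x + a * 2).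
  have := @is_derive_line R V _ ('D_v f) x v 0; rewrite scale0r add0r => /(_ d2f) dfh.
  apply: is_deriveD; have := is_derive_affine (a * 2) b 0.
  by congr (is_derive _ _ _ _); apply/funext => h; rewrite mulrA.
have : \forall h \near (0 : R), derivable f (h *: v + x) v /\ g h <= f x.
  by apply: filterS2 (near_line x v _ df) fmax => h; rewrite -addrA; split.
move=> /nbhs_ballP[d /= d0 Hd].
have g0 : g 0 = f x by rewrite /g scale0r add0r expr0n /= !mulr0 !addr0.
have G0 : G 0 = 0.
  have [] : is_derive (0 : R) 1 g 0.
    apply: (@derive1_at_max _ g (- d) d).
    - by lra.
    - move=> t; rewrite in_itv /= => td; have [|+ _] := Hd t; last by move=> /dg[].
      by rewrite -ball_normE /= sub0r normrN ltr_norml.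
    - by rewrite in_itv /= oppr_lt0 d0.
    - move=> t; rewrite in_itv /= g0 => td; apply: (Hd t _).2.
      by rewrite -ball_normE /= sub0r normrN ltr_norml.
  have [|+ _] := Hd 0; first exact: ballxx.
  by move=> /dg[_ ->] _ ->.
rewrite leNgt; apply/negP => D2.
have c0 : 0 < 'D_v ('D_v f) x + a * 2 by lra.
(* The derivative of [G] at 0, positive by assumption, is taken as the tolerance, so the nearby
   quotients [G h / h] are positive. *)
case: dG => dG DG; move/cvgrPdist_lt : dG; rewrite -/(derive _ _ _) DG.
move=> /(_ _ c0); rewrite /= near_withinE => /nbhs_ballP[r /= r0 Hr].
have [h [h0 hd hr]] : exists h : R, [/\ 0 < h, h < d & h < r].
  have m0 : 0 < Num.min d r by rewrite lt_min d0.
  exists (Num.min d r / 2); rewrite divr_gt0//; split=> //.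
    by apply: (@lt_le_trans _ _ (Num.min d r)); [lra|rewrite ge_min lexx].
  by apply: (@lt_le_trans _ _ (Num.min d r)); [lra|rewrite ge_min lexx orbT].
have Hin (t : R) : t \in `[0, h]%R -> is_derive t 1 g (G t).
  rewrite in_itv /= => /andP[t0 th]; apply: dg; apply: (Hd t _).1.
  by rewrite -ball_normE /= sub0r normrN ger0_norm//; lra.
have Hin' (t : R) : t \in `]0, h[%R -> is_derive t 1 g (G t).
  by move=> th; apply: Hin; exact: subset_itv_oo_cc.
have cg : {within `[0, h], continuous g}.
  by apply: derivable_within_continuous => t /Hin /@ex_derive.
have [c + E] := MVT h0 Hin' cg.
rewrite in_itv /= => /andP[c_gt0 ch].
have : 0 < G c.
  have := Hr c; rewrite -ball_normE /= sub0r normrN gtr0_norm// => /(_ (lt_trans ch hr)).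
  rewrite gt_eqF// => /(_ isT); rewrite [c%:A]mulr1 addr0 G0 subr0 -[_ *: _]/(_ * _).
  rewrite ltr_distlC => /andP[+ _]; rewrite subrr pmulr_rgt0// invr_gt0//.
have := (Hd h _).2; rewrite -ball_normE /= sub0r normrN gtr0_norm// => /(_ hd).
rewrite -g0 -subr_le0 E subr0 pmulr_lle0//; lra.
Qed.

(** The chain rule along any filter finer than [0^'], so that one-sided quotients on the walls of
    the strip are covered. The remainder of [phi] is small relative to [g h - g0], hence relative to
    [h], because the quotients of [g] are eventually bounded by the norm of [w] plus 1. *)
Lemma cvg_quotient_comp {W : normedModType R} (F : set_system R) {FF : Filter F}
    (g : R -> V) g0 w (phi : V -> W) :
  F --> (0 : R)^' ->
  h^-1 *: (g h - g0) @[h --> F] --> w -> differentiable phi g0 ->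
  h^-1 *: (phi (g h) - phi g0) @[h --> F] --> 'd phi g0 w.
Proof.
move=> F0 gw dphi.
have Fn0 : \forall h \near F, h != 0 by apply: F0; exact: (@nbhs_dnbhs_neq R 0).
have F00 : h @[h --> F] --> (0 : R) by apply: cvg_trans F0 _; exact: cvg_within.
have gg : g h - g0 @[h --> F] --> (0 : V).
  have H : h *: (h^-1 *: (g h - g0)) @[h --> F] --> (0 : R) *: w by exact: cvgZ.
  rewrite scale0r in H; apply: cvg_trans H; apply: near_eq_cvg.
  by apply: filterS Fn0 => h h0; rewrite scalerA divff// scale1r.
pose r (k : V) := phi (k + g0) - phi g0 - 'd phi g0 k.
have r_small (e : R) : 0 < e -> \forall k \near (0 : V), `|r k| <= e * `|k|.
  move=> e0; have /diff_locally /eqaddoP /(_ _ e0) := dphi; apply: filterS => k; apply: le_trans.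
  by rewrite /r /= le_eqVlt; apply/orP; left; apply/eqP; congr (`|_|); rewrite /= opprD addrA.
have rh : h^-1 *: r (g h - g0) @[h --> F] --> (0 : W).
  apply/cvgr0Pnorm_le => e e0.
  have e'0 : 0 < e / (`|w| + 1) by rewrite divr_gt0// ltr_wpDl.
  have gb : \forall h \near F, `|h^-1 *: (g h - g0)| <= `|w| + 1.
    have /cvgrPdist_le := gw => /(_ 1 ltr01); apply: filterS => h Hh.
    by rewrite -lerBlDl; apply: le_trans Hh; rewrite distrC; exact: lerB_dist.
  apply: filterS3 Fn0 gb (gg _ (r_small _ e'0)) => h h0 Hb Hr.
  rewrite normrZ; apply: (@le_trans _ _ (`|h^-1| * (e / (`|w| + 1) * `|g h - g0|))).
    by rewrite ler_wpM2l.
  rewrite mulrCA -normrZ -[leRHS](@divfK _ (`|w| + 1)) ?gt_eqF ?ltr_wpDl//.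
  by rewrite ler_wpM2l// ltW.
have : 'd phi g0 (h^-1 *: (g h - g0)) + h^-1 *: r (g h - g0) @[h --> F] --> 'd phi g0 w + 0.
  apply: cvgD rh; apply: continuous_cvg gw; exact: diff_continuous.
rewrite addr0; apply: cvg_trans; apply: near_eq_cvg.
apply: nearW => h; rewrite /r subrK linearZ /= -scalerDr; congr (_ *: _).
by rewrite addrC subrK.
Qed.

End SecondOrder.

(** * The Laplacian of a function with paired differential *)

Section Pairing.
Context {R : realType} {P : normedModType R}.

Lemma is_derive_comp_diff {V W : normedModType R} (u : P -> V) (g : V -> W) p e :
  derivable u p e -> differentiable g (u p) ->
  is_derive p e (g \o u) ('d g (u p) ('D_e u p)).
Proof.
move=> du dg.
have H : h^-1 *: (g (u (h *: e + p)) - g (u p)) @[h --> (0 : R)^'] --> 'd g (u p) ('D_e u p).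
  apply: (@cvg_quotient_comp _ _ _ _ _ (fun h : R => u (h *: e + p))) => //.
by split; [apply/cvg_ex; eexists; exact: H|apply: cvg_lim H].
Qed.

Lemma near_eq_differentiable {V W : normedModType R} (f g : V -> W) x :
  {near x, f =1 g} -> differentiable f x -> differentiable g x.
Proof.
move=> fg df; apply: (@differentiable_eps _ _ _ _ ('d f x)).
  exact: diff_continuous.
move=> e e0; have /diff_locally /eqaddoP /(_ _ e0) := df.
have fg0 : \forall h \near (0 : V), f (h + x) = g (h + x).
  have cx : h + x @[h --> (0 : V)] --> x.
    by rewrite -[X in _ --> X]add0r; apply: cvgD; [exact: cvg_id|exact: cvg_cst].
  exact: (cx _ fg).
apply: filterS2 fg0 => h Eh; rewrite -Eh -(nbhs_singleton fg) /=.
by apply: le_trans; rewrite /cst /= opprD addrA.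
Qed.

(** A one-form in coordinates, with the vector as first argument and the base point as second:
    linear near [y0], with coefficients differentiable at [y0]. *)
Definition linear_form_near {n : nat} (a : 'cV[R]_n -> 'cV[R]_n -> R) (y0 : 'cV[R]_n) :=
  (\forall y \near y0, forall v, a v y = \sum_i v i ord0 * a (delta_mx i ord0) y) /\
  (forall i : 'I_n, differentiable (a (delta_mx i ord0)) y0).

Context {n : nat}.
Implicit Types (a : 'cV[R]_n -> 'cV[R]_n -> R) (u w : P -> 'cV[R]_n).

Lemma derive_coord {V : normedModType R} (w : V -> 'cV[R]_n) p e i :
  derivable w p e -> is_derive p e (fun p => w p i ord0) ('D_e w p i ord0).
Proof.
move=> dw; split; first exact: (derivable_mxP _ _ _).1 dw i ord0.
by rewrite derive_mx// mxE.
Qed.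

(** The product rule, applied to each term of the expansion of the form in its coefficients. One
    summand freezes the vector [w p], the other freezes the base point [u p]. *)
Lemma is_derive_pairing a u w p e : linear_form_near a (u p) ->
  {for p, continuous u} -> derivable u p e -> derivable w p e ->
  is_derive p e (fun p => a (w p) (u p))
    ('D_('D_e u p) (a (w p)) (u p) + a ('D_e w p) (u p)).
Proof.
move=> [alin da] cu du dw.
pose E (i : 'I_n) : 'cV[R]_n := delta_mx i ord0.
have D1 (v : 'cV[R]_n) : is_derive (u p) ('D_e u p) (a v)
    (\sum_i v i ord0 * 'd (a (E i)) (u p) ('D_e u p)).
  apply: (@near_eq_is_derive _ _ _ (\sum_i (v i ord0 \*: a (E i)))).
    by apply: filterS alin => y ->; rewrite fct_sumE.
  have -> : \sum_i v i ord0 * 'd (a (E i)) (u p) ('D_e u p) =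
     \sum_i (v i ord0 *: 'd (a (E i)) (u p) ('D_e u p)) by [].
  have dv (i : 'I_n) : derivable (a (E i)) (u p) ('D_e u p) by apply: diff_derivable; exact: da.
  split; first by apply: derivable_sum => i; apply: derivableZ.
  rewrite derive_sum; last by move=> i; apply: derivableZ.
  by apply: eq_bigr => i _; rewrite (deriveZ _ (dv i)) (deriveE _ (da i)).
rewrite (@derive_val _ _ _ _ _ _ _ (D1 (w p))).
rewrite ((nbhs_singleton alin) ('D_e w p)) -big_split /=.
apply: (@near_eq_is_derive _ _ _ (\sum_i (fun p => w p i ord0 * a (E i) (u p)))).
  have alinu : \forall q \near p,
      forall v, a v (u q) = \sum_i v i ord0 * a (delta_mx i ord0) (u q) := cu _ alin.
  by apply: filterS alinu => q /= ->; rewrite fct_sumE.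
have dterm (i : 'I_n) : is_derive p e (fun p => w p i ord0 * a (E i) (u p))
   (w p i ord0 * 'd (a (E i)) (u p) ('D_e u p) + 'D_e w p i ord0 * a (E i) (u p)).
  have := is_derive_comp_diff u (a (E i)) p e du (da i) => d1.
  have := derive_coord w p e i dw => d2.
  have := @is_deriveM _ _ _ _ _ _ _ _ d2 d1.
  by rewrite [X in is_derive _ _ _ X -> _](_ : _ =
       w p i ord0 * 'd (a (E i)) (u p) ('D_e u p) + 'D_e w p i ord0 * a (E i) (u p))//
     /GRing.scale /= (mulrC (a _ _)).
split; first by apply: derivable_sum => i; exact: (@ex_derive _ _ _ _ _ _ _ (dterm i)).
rewrite derive_sum; last by move=> i; exact: (@ex_derive _ _ _ _ _ _ _ (dterm i)).
by apply: eq_bigr => i _; exact: (@derive_val _ _ _ _ _ _ _ (dterm i)).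
Qed.

Lemma schwarz (O : set P) u p e1 e2 :
  open O -> Ck_on 2 O u -> O p -> 'D_e2 ('D_e1 u) p = 'D_e1 ('D_e2 u) p.
Proof.
move=> oO C2 Op.
have C1 : Ck_on 1 O u := Ck_onS _ _ _ C2.
have dD e e' : derivable ('D_e u) p e'.
  exact: Ck_on_derivable (Ck_on_derive _ _ _ e oO C2) Op.
have H e e' i : 'D_e' ('D_e u) p i ord0 = 'D_e' ('D_e (fun q => u q i ord0)) p.
  rewrite -(@derive_val _ _ _ _ _ _ _ (derive_coord _ _ e' i (dD e e'))).
  apply: near_eq_derive; apply: filterS (open_nbhs_nbhs (conj oO Op)) => q Oq.
  rewrite (@derive_val _ _ _ _ _ _ _ (derive_coord _ _ e i _))//.
  exact: Ck_on_derivable C1 Oq.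
apply/colP => i; refine (etrans (H e1 e2 i) (etrans _ (esym (H e2 e1 i)))).
exact: (schwarz_scalar O _ p e1 e2 oO (Ck_on_coord 2 O u i ord0 oO C2) Op).
Qed.

End Pairing.

(** The exterior derivative of the one-form [a], evaluated on constant vector fields. *)
Definition ext_pairing {R : realType} {n : nat} (a : 'cV[R]_n -> 'cV[R]_n -> R)
    (y v w : 'cV[R]_n) : R :=
  'D_v (a w) y - 'D_w (a v) y.

Lemma ext_pairingvv {R : realType} {n : nat} (a : 'cV[R]_n -> 'cV[R]_n -> R) y v :
  ext_pairing a y v v = 0.
Proof. exact: subrr. Qed.

Section Laplacian.
Context {R : realType} {P : normedModType R} {n : nat}.

(* With [a_I = d rho \o I] etc. this is the computation
   [d * df = d (a_I /\ d tau + a_J /\ d s + a_K /\ d t)]. *)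
Lemma laplacian_pairing (aI aJ aK : 'cV[R]_n -> 'cV[R]_n -> R) (u : P -> 'cV[R]_n)
    (f : P -> R) (O : set P) p (e1 e2 e3 : P) :
  open O -> Ck_on 2 O u -> O p ->
  linear_form_near aI (u p) -> linear_form_near aJ (u p) -> linear_form_near aK (u p) ->
  (\forall q \near p, 'D_e1 f q = aK ('D_e2 u q) (u q) - aJ ('D_e3 u q) (u q)) ->
  (\forall q \near p, 'D_e2 f q = aI ('D_e3 u q) (u q) - aK ('D_e1 u q) (u q)) ->
  (\forall q \near p, 'D_e3 f q = aJ ('D_e1 u q) (u q) - aI ('D_e2 u q) (u q)) ->
  [/\ derivable ('D_e1 f) p e1, derivable ('D_e2 f) p e2, derivable ('D_e3 f) p e3 &
    'D_e1 ('D_e1 f) p + 'D_e2 ('D_e2 f) p + 'D_e3 ('D_e3 f) p =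
    ext_pairing aI (u p) ('D_e2 u p) ('D_e3 u p)
    + ext_pairing aJ (u p) ('D_e3 u p) ('D_e1 u p)
    + ext_pairing aK (u p) ('D_e1 u p) ('D_e2 u p)].
Proof.
move=> oO C2 Op lI lJ lK E1 E2 E3.
have C1 : Ck_on 1 O u := Ck_onS _ _ _ C2.
have dD e e' : derivable ('D_e u) p e'.
  exact: Ck_on_derivable (Ck_on_derive _ _ _ e oO C2) Op.
have cu : {for p, continuous u} by exact: Ck_on_continuous C1 Op.
have dpair a b e e' e'' : linear_form_near a (u p) -> linear_form_near b (u p) ->
   (\forall q \near p, 'D_e f q = a ('D_e' u q) (u q) - b ('D_e'' u q) (u q)) ->
   is_derive p e ('D_e f)
    ('D_('D_e u p) (a ('D_e' u p)) (u p) + a ('D_e ('D_e' u) p) (u p)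
    - ('D_('D_e u p) (b ('D_e'' u p)) (u p) + b ('D_e ('D_e'' u) p) (u p))).
  move=> la lb Eab.
  apply: (@near_eq_is_derive _ _ _ (fun q => a ('D_e' u q) (u q) - b ('D_e'' u q) (u q))).
    by apply: filterS Eab => q ->.
  have du : derivable u p e by exact: Ck_on_derivable C1 Op.
  exact: is_deriveB (is_derive_pairing _ _ _ _ _ la cu du (dD e' e))
                    (is_derive_pairing _ _ _ _ _ lb cu du (dD e'' e)).
have [d1 ->] := dpair _ _ _ _ _ lK lJ E1.
have [d2 ->] := dpair _ _ _ _ _ lI lK E2.
have [d3 ->] := dpair _ _ _ _ _ lJ lI E3.
(* The terms containing mixed second derivatives of [u] occur in pairs of opposite sign and cancel
   by symmetry; the other six form the three exterior derivatives. *)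
have regroup (A1 A2 B1 B2 C1' C2' x y z x' y' z' : R) : x = x' -> y = y' -> z = z' ->
    A1 + x - (A2 + y) + (B1 + z - (B2 + x')) + (C1' + y' - (C2' + z'))
    = B1 - C2' + (C1' - A2) + (A1 - B2).
  by move=> -> -> ->; ring.
split=> //; rewrite /ext_pairing; apply: regroup.
- exact: (congr1 (aK^~ (u p)) (schwarz _ _ _ e2 e1 oO C2 Op)).
- exact: (congr1 (aJ^~ (u p)) (schwarz _ _ _ e3 e1 oO C2 Op)).
- exact: (congr1 (aI^~ (u p)) (schwarz _ _ _ e3 e2 oO C2 Op)).
Qed.

End Laplacian.

(** * Charts *)

Lemma open_preimage_within {S T : topologicalType} (f : S -> T) (O : set S) (B : set T) :
  open O -> {within O, continuous f} -> open B -> open (O `&` f @^-1` B).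
Proof.
by move=> oO cf oB; move: cf; rewrite continuous_open_subspace// => /(continuous_inP _ oO); apply.
Qed.

Section Charts.
Context {R : realType} {n : nat} {M : topologicalType}.
Implicit Types (c : chart R n M) (x : M).

Lemma coord_image c (B : set M) :
  coord c @` (dom c `&` B) = coord c @` dom c `&` point_of c @^-1` B.
Proof.
apply/seteqP; split=> [_ [x [cx Bx] <-]|_ [[x cx <-]]] /=.
  by split; [exists x|rewrite coordK].
by rewrite /= coordK// => Bx; exists x.
Qed.

Lemma open_coord_image c (B : set M) : open B -> open (coord c @` (dom c `&` B)).
Proof.
move=> oB; rewrite coord_image; apply: open_preimage_within => //.
  exact: coord_open.
exact: point_of_continuous.
Qed.

Lemma dom_point_of c y : (coord c @` dom c) y -> dom c (point_of c y).
Proof. by case=> x cx <-; rewrite coordK. Qed.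

Lemma point_ofK c y : (coord c @` dom c) y -> coord c (point_of c y) = y.
Proof. by case=> x cx <-; rewrite coordK. Qed.

Lemma near_point_of c x (B : set M) : dom c x -> nbhs x B ->
  \forall y \near coord c x, B (point_of c y).
Proof.
move=> cx xB; have := @point_of_continuous _ _ _ c.
rewrite (continuous_open_subspace _ (@coord_open _ _ _ c)) => /(_ (coord c x)).
rewrite inE => /(_ (imageP _ cx)); apply.
by rewrite /= coordK.
Qed.

Lemma near_coord c x (B : set 'cV[R]_n) : dom c x -> nbhs (coord c x) B ->
  \forall y \near x, B (coord c y).
Proof.
move=> cx xB; have := @coord_continuous _ _ _ c.
rewrite (continuous_open_subspace _ (@dom_open _ _ _ c)) => /(_ x).
by rewrite inE => /(_ cx); apply.
Qed.

Lemma nbhs_dom c x : dom c x -> nbhs x (dom c).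
Proof. by move=> cx; apply: open_nbhs_nbhs; split=> //; exact: dom_open. Qed.

Lemma nbhs_coord_dom c x : dom c x -> nbhs (coord c x) (coord c @` dom c).
Proof.
by move=> cx; apply: open_nbhs_nbhs; split; [exact: coord_open|exact: imageP].
Qed.

Context (X : manifold R n M).

Lemma transition_differentiable c c' x : atlas X c -> atlas X c' ->
  dom c x -> dom c' x -> differentiable (coord c' \o point_of c) (coord c x).
Proof.
move=> Ac Ac' cx c'x; apply: (C1_differentiable (coord c @` (dom c `&` dom c'))).
- by apply: open_coord_image; exact: dom_open.
- exact: atlas_smooth Ac Ac' 1%N.
- by exists x.
Qed.

Lemma coord_changeE c c' x v : atlas X c -> atlas X c' -> dom c x -> dom c' x ->
  coord_change c c' x v = 'd (coord c' \o point_of c) (coord c x) v.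
Proof. by move=> *; rewrite /coord_change deriveE//; exact: transition_differentiable. Qed.

Lemma derive_change {W : normedModType R} (g : M -> W) c c' x v :
  atlas X c -> atlas X c' -> dom c x -> dom c' x ->
  differentiable (g \o point_of c') (coord c' x) ->
  'D_v (g \o point_of c) (coord c x)
  = 'D_(coord_change c c' x v) (g \o point_of c') (coord c' x).
Proof.
move=> Ac Ac' cx c'x dg.
have dT := transition_differentiable _ _ _ Ac Ac' cx c'x.
pose T := coord c' \o point_of c.
have ET : T (coord c x) = coord c' x by rewrite /T /= coordK.
rewrite (@near_eq_derive _ _ _ _ ((g \o point_of c') \o T)); last first.
  have := near_point_of _ _ _ cx (nbhs_dom _ _ c'x).
  by apply: filterS => y c'y; rewrite /T /= coordK.
have dg' : differentiable (g \o point_of c') (T (coord c x)) by rewrite ET.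
rewrite (@derive_val _ _ _ _ _ _ _ (is_derive_comp_diff T _ _ v (diff_derivable dT) dg')).
by rewrite ET [RHS]deriveE.
Qed.

Context (rho : M -> R) (rho_smooth : smooth_function X rho).

Lemma rho_differentiable c y : atlas X c -> (coord c @` dom c) y ->
  differentiable (rho \o point_of c) y.
Proof.
move=> Ac cy; apply: (C1_differentiable_scalar (coord c @` dom c)) => //.
  exact: coord_open.
exact: rho_smooth.
Qed.

Lemma rho_continuous : continuous rho.
Proof.
move=> x; pose c := chart_at X x; have cx : dom c x := chart_at_dom X x.
have Ac : atlas X c := chart_at_atlas X x.
have /differentiable_continuous cr := rho_differentiable _ _ Ac (imageP _ cx).
move=> B xB; have : nbhs ((rho \o point_of c) (coord c x)) B by rewrite /= coordK.
move=> /cr /(near_coord _ _ _ cx) H.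
by apply: filterS2 (nbhs_dom _ _ cx) H => y cy /=; rewrite coordK.
Qed.

Lemma differential_in_chart c x v : atlas X c -> dom c x ->
  differential X rho x v
  = 'D_(coord_change (chart_at X x) c x v) (rho \o point_of c) (coord c x).
Proof.
move=> Ac cx; apply: derive_change => //; first exact: chart_at_atlas.
  exact: chart_at_dom.
by apply: rho_differentiable => //; exact: imageP.
Qed.

Lemma differentialE x v :
  differential X rho x v = 'd (rho \o point_of (chart_at X x)) (coord (chart_at X x) x) v.
Proof.
rewrite /differential deriveE//; apply: rho_differentiable; first exact: chart_at_atlas.
by apply: imageP; exact: chart_at_dom.
Qed.

Lemma differentialB x v w :
  differential X rho x (v - w) = differential X rho x v - differential X rho x w.
Proof. by rewrite !differentialE linearB. Qed.

Context (I : M -> 'M[R]_n) (I_smooth : smooth_endomorphism X I).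

Let alpha : one_form R n M := fun y u => differential X rho y (I y *m u).

(** The preferred chart in the definition of [alpha] may jump with the point, so regularity is read
    off in the fixed chart [c]. There the form is a sum of components of the transported
    endomorphism, smooth by [I_smooth], times partial derivatives of [rho]. *)
Lemma form_linear_near c y0 : atlas X c -> (coord c @` dom c) y0 ->
  linear_form_near (form_in_chart X c alpha) y0.
Proof.
move=> Ac cy0; pose E (i : 'I_n) : 'cV[R]_n := delta_mx i ord0.
pose It (v : 'cV[R]_n) y := let x := point_of c y in
         coord_change (chart_at X x) c x
           (I x *m coord_change c (chart_at X x) x v).
have formE v y : (coord c @` dom c) y ->
    form_in_chart X c alpha v y = \sum_i It v y i ord0 * 'D_(E i) (rho \o point_of c) y.
  case=> x cx <-; rewrite /form_in_chart /alpha (differential_in_chart c) ?coordK//.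
  rewrite deriveE; last by apply: rho_differentiable => //; exact: imageP.
  rewrite linear_lincomb; apply: eq_bigr => i _.
  rewrite /It coordK// deriveE//.
  by apply: rho_differentiable => //; exact: imageP.
have noO : nbhs y0 (coord c @` dom c).
  by apply: open_nbhs_nbhs; split=> //; exact: coord_open.
split.
  apply: filterS noO => _ [x cx <-] v.
  rewrite /form_in_chart /alpha coordK// [in LHS](matrix_sum_delta v).
  rewrite differentialE coord_changeE//;
   [|exact: chart_at_atlas|exact: chart_at_dom].
  rewrite linear_sum mulmx_sumr linear_sum; apply: eq_bigr => i _.
  rewrite big_ord1 linearZ -scalemxAr linearZ /=.
  apply: (congr1 (fun r : R => v i ord0 * r)).
  rewrite [RHS]differentialE coord_changeE//;
   [exact: chart_at_atlas|exact: chart_at_dom].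
move=> i.
apply: (@near_eq_differentiable _ _ _ 
  (\sum_k (fun y => It (E i) y k ord0 * 'D_(E k) (rho \o point_of c) y))).
  by apply: filterS noO => y /(formE (E i)) ->; rewrite fct_sumE.
apply: differentiable_sum => k; apply: differentiableM.
  apply: (C1_differentiable_scalar _ _ _ (@coord_open _ _ _ c) _ cy0).
  by apply: (Ck_on_coord 1); [exact: coord_open|exact: I_smooth Ac (E i) 1%N].
apply: (C1_differentiable_scalar _ _ _ (@coord_open _ _ _ c) _ cy0).
apply: Ck_on_derive; first exact: coord_open.
exact: rho_smooth Ac 2%N.
Qed.

End Charts.

(** * Derivatives of maps into the manifold *)

Section QuaternionAlgebra.
Context {R : realType} {n : nat} (I J K : 'M[R]_n).
Hypotheses (II : I *m I = - 1%:M) (JJ : J *m J = - 1%:M) (KK : K *m K = - 1%:M).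
Hypothesis IJ : I *m J = K.

(** The three identities are the equation multiplied on the left by [I], [J] and [K], once the
    quaternion multiplication table is known. *)
Lemma fueter_solve (a b c : 'cV[R]_n) : I *m a + J *m b + K *m c = 0 ->
  [/\ a = K *m b - J *m c, b = I *m c - K *m a & c = J *m a - I *m b].
Proof.
have IK : I *m K = - J by rewrite -IJ mulmxA II mulNmx mul1mx.
have KJ : K *m J = - I by rewrite -IJ -mulmxA JJ mulmxN mulmx1.
have JI : J *m I = - K.
  (* Anticommutation of [I] and [J]: substituting [K = I *m J] collapses the product [I K K J] to
     [J I], while [K *m K = - 1%:M] makes it [- K]. *)
  have : I *m (K *m K) *m J = J *m I.
    by rewrite -IJ !mulmxA II -!mulmxA JJ !mulmxN mulmx1 mulNmx mul1mx opprK.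
  by rewrite KK mulmxN mulmx1 mulNmx IJ => <-.
have JK : J *m K = I by rewrite -IJ mulmxA JI mulNmx KJ opprK.
have KI : K *m I = J by rewrite -IJ -mulmxA JI mulmxN IK opprK.
move=> E.
have EI : I *m (I *m a + J *m b + K *m c) = 0 by rewrite E mulmx0.
have EJ : J *m (I *m a + J *m b + K *m c) = 0 by rewrite E mulmx0.
have EK : K *m (I *m a + J *m b + K *m c) = 0 by rewrite E mulmx0.
move: EI EJ EK; rewrite !mulmxDr !mulmxA II IJ IK JI JJ JK KI KJ KK !mulNmx !mul1mx.
move=> EI EJ EK; split.
- by move/eqP: EI; rewrite -addrA addrC subr_eq0 => /eqP <-.
- by move/eqP: EJ; rewrite addrAC subr_eq0 addrC => /eqP <-.
- by move/eqP: EK; rewrite subr_eq0 => /eqP <-.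
Qed.

End QuaternionAlgebra.

Section MapCalculus.
Context {R : realType} {n : nat} {M : topologicalType} (X : manifold R n M).
Context {V : normedModType R} (D : set V) (U : V -> M).
Hypothesis CU : Ck_map X D 1 U.
Implicit Types (c : chart R n M).

Lemma near_map_dom c p : dom c (U p) -> D p -> \forall q \near p, D q -> dom c (U q).
Proof.
move=> cp Dp; have [/subspace_continuousP cU _] := CU.
exact: (cU _ Dp _ (nbhs_dom _ _ cp)).
Qed.

Lemma map_derive_cvg c p v : atlas X c -> dom c (U p) -> D p ->
  quotient_within D (coord c \o U) p v --> derive_within D (coord c \o U) p v.
Proof.
move=> Ac cp Dp; have [_ /(_ _ Ac) [_ [dU _]]] := CU.
have /= := dU p v (conj Dp cp).
rewrite /derivable_within (@quotient_within_near _ _ _ _ D)//.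
by apply: filterS (near_map_dom _ _ cp Dp) => q H; split=> [[]//|Dq]; split=> //; exact: H.
Qed.

(** The chain rule for [rho \o U] through the preferred chart at [U p]. It holds at boundary points
    of [D] too, which is what the Neumann condition requires. *)
Lemma quotient_rho_cvg rho p v : smooth_function X rho -> D p ->
  quotient_within D (rho \o U) p v --> differential X rho (U p) (map_derive X D U p v).
Proof.
move=> srho Dp; pose c := chart_at X (U p).
have cp : dom c (U p) := chart_at_dom X (U p).
have Ac : atlas X c := chart_at_atlas X (U p).
rewrite (differentialE _ _ srho).
pose F := within [set h : R | D (h *: v + p)] (0 : R)^'.
have dphi := rho_differentiable _ _ srho c (coord c (U p)) Ac (imageP _ cp).
have F0 : F --> (0 : R)^' by exact: cvg_within.
have FF : Filter F by exact: within_filter.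
have H := @cvg_quotient_comp _ _ _ F FF (fun h => coord c (U (h *: v + p))) _ _ _
  F0 (map_derive_cvg c p v Ac cp Dp) dphi.
have nF : \forall h \near F, dom c (U (h *: v + p)).
  rewrite /F near_withinE.
  by apply: near_line_dnbhs (near_map_dom _ _ cp Dp).
apply: cvg_trans H; apply: near_eq_cvg.
by apply: filterS nF => h ch /=; rewrite !coordK.
Qed.

Lemma derive_rho rho p v : smooth_function X rho -> nbhs p D ->
  is_derive p v (rho \o U) (differential X rho (U p) (map_derive X D U p v)).
Proof.
move=> srho nD; have := quotient_rho_cvg rho p v srho (nbhs_singleton nD).
rewrite (quotient_within_interior D (rho \o U) p v nD) => H.
by split; [apply/cvg_ex; eexists; exact: H|apply: cvg_lim H].
Qed.

(** [map_derive] uses a chart that changes with [p]; a fixed chart is needed before the derivative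
    can itself be differentiated. *)
Lemma map_derive_change c p v : atlas X c -> dom c (U p) -> nbhs p D ->
  map_derive X D U p v =
  coord_change c (chart_at X (U p)) (U p) ('D_v (coord c \o U) p).
Proof.
move=> Ac cp nD; have Dp := nbhs_singleton nD.
pose c' := chart_at X (U p).
have c'p : dom c' (U p) := chart_at_dom X (U p).
have Ac' : atlas X c' := chart_at_atlas X (U p).
have dT := transition_differentiable X c c' (U p) Ac Ac' cp c'p.
rewrite /map_derive derive_within_interior// (coord_changeE X)//.
rewrite (@near_eq_derive _ _ _ _ ((coord c' \o point_of c) \o (coord c \o U))); last first.
  by apply: filterS2 nD (near_map_dom _ _ cp Dp) => q Dq /(_ Dq) cq /=; rewrite coordK.
have du : derivable (coord c \o U) p v.
  by rewrite -(derivable_within_interior D)//; apply/cvg_ex; eexists; exact: map_derive_cvg.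
exact: (@derive_val _ _ _ _ _ _ _ (is_derive_comp_diff (coord c \o U) _ _ v du dT)).
Qed.

End MapCalculus.

(** * Fueter maps are subharmonic *)

Section TripleMap.
Context {R : realType} {n : nat}.

(** The linear map with values [a], [b], [c] on the coordinate frame. For the three partial
    derivatives of [U] it is the differential of [U], to which convexity is applied. *)
Definition triple_map (a b c : 'cV[R]_n) (z : R * R * R) : 'cV[R]_n :=
  z.1.1 *: a + z.1.2 *: b + z.2 *: c.

Lemma triple_map_is_linear a b c : linear (triple_map a b c).
Proof.
move=> k u v; rewrite /triple_map /= !scalerDl !scalerDr !scalerA.
by rewrite (addrACA (_ *: a)) (addrACA (_ + _)).
Qed.

Lemma triple_mapE a b c :
  [/\ triple_map a b c (e_tau R) = a, triple_map a b c (e_s R) = b &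
      triple_map a b c (e_t R) = c].
Proof.
by rewrite /triple_map /e_tau /e_s /e_t /= !scale1r !scale0r !add0r !addr0.
Qed.

HB.instance Definition _ a b c :=
  GRing.isLinear.Build R (R * R * R)%type 'cV[R]_n *:%R (triple_map a b c)
    (triple_map_is_linear a b c).

End TripleMap.

Section FueterLaplacian.
Context {R : realType} {n : nat} {M : topologicalType} (X : manifold R n M).
Context (I J K : M -> 'M[R]_n) (rho : M -> R) (U : R * R * R -> M).
Hypotheses (qIJK : almost_quaternionic X I J K) (srho : smooth_function X rho).
Hypotheses (CU : Ck_map X (@strip3 R) 2 U) (FU : fueter_equation X I J K U).

Let alpha (A : M -> 'M[R]_n) : one_form R n M :=
  fun y u => differential X rho y (A y *m u).

Lemma Ck_map_1 : Ck_map X (@strip3 R) 1 U.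
Proof.
by have [cU dU] := CU; split=> // c Ac; exact: Ck_onS (dU c Ac).
Qed.

Lemma fueter_map_derive p : strip3 p ->
  let d := map_derive X (@strip3 R) U p in
  [/\ d (e_tau R) = K (U p) *m d (e_s R) - J (U p) *m d (e_t R),
      d (e_s R) = I (U p) *m d (e_t R) - K (U p) *m d (e_tau R) &
      d (e_t R) = J (U p) *m d (e_tau R) - I (U p) *m d (e_s R)].
Proof.
move=> Dp; have [[_ II] [_ JJ] [_ KK] IJ] := qIJK.
by apply: fueter_solve (FU p Dp).
Qed.

Lemma volume_frame : volume (e_tau R) (e_s R) (e_t R) = 1.
Proof. by rewrite /volume /wedge21 /wedge11 /d_tau /d_s /d_t /=; ring. Qed.

(** On the frame each of [d_tau], [d_s], [d_t] is non-zero on one vector only, so each wedge keeps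
    one cyclic term. The overall sign is the one in the definition of [sigma_of]. *)
Lemma sigma_frame x v1 v2 v3 :
  let c := chart_at X x in
  sigma_rho X I J K rho x (e_tau R, v1) (e_s R, v2) (e_t R, v3) =
  - (ext_pairing (form_in_chart X c (alpha I)) (coord c x) v2 v3
     + ext_pairing (form_in_chart X c (alpha J)) (coord c x) v3 v1
     + ext_pairing (form_in_chart X c (alpha K)) (coord c x) v1 v2).
Proof.
move=> c; pose aI := form_in_chart X c (alpha I); pose aJ := form_in_chart X c (alpha J).
pose aK := form_in_chart X c (alpha K).
have frame (sI sJ sK : 'cV[R]_n -> 'cV[R]_n -> R) :
  wedge21 (fun a b : (R * R * R) * 'cV[R]_n => sI a.2 b.2) (fun a => d_tau a.1)
    (e_tau R, v1) (e_s R, v2) (e_t R, v3)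
  + wedge21 (fun a b : (R * R * R) * 'cV[R]_n => sJ a.2 b.2) (fun a => d_s a.1)
    (e_tau R, v1) (e_s R, v2) (e_t R, v3)
  + wedge21 (fun a b : (R * R * R) * 'cV[R]_n => sK a.2 b.2) (fun a => d_t a.1)
    (e_tau R, v1) (e_s R, v2) (e_t R, v3)
  = sI v2 v3 + sJ v3 v1 + sK v1 v2.
  by rewrite /wedge21 /d_tau /d_s /d_t /= !(mulr0, mulr1, addr0, add0r).
have oppr3 (x1 x2 x3 : R) : - x1 - x2 - x3 = - (x1 + x2 + x3) by rewrite !opprD.
refine (etrans (frame (fun v w => - ext_pairing aI (coord c x) v w)
  (fun v w => - ext_pairing aJ (coord c x) v w)
  (fun v w => - ext_pairing aK (coord c x) v w)) (oppr3 _ _ _)).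
Qed.

(** In the chart at [U p], [fueter_map_derive] gives the hypotheses of [laplacian_pairing], and by
    [sigma_frame] the resulting Laplacian is minus the coefficient that convexity makes negative. *)
Lemma laplacian_ge0 p : nbhs p (@strip3 R) -> IJK_convex_at X I J K rho (U p) ->
  let f := rho \o U in
  [/\ derivable ('D_(e_tau R) f) p (e_tau R), derivable ('D_(e_s R) f) p (e_s R),
      derivable ('D_(e_t R) f) p (e_t R) &
  0 <= 'D_(e_tau R) ('D_(e_tau R) f) p + 'D_(e_s R) ('D_(e_s R) f) p
       + 'D_(e_t R) ('D_(e_t R) f) p].
Proof.
move=> nD cvx f; have CU1 := Ck_map_1.
have [[sI _] [sJ _] [sK _] _] := qIJK.
pose c := chart_at X (U p).
have cp : dom c (U p) := chart_at_dom X (U p).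
have Ac : atlas X c := chart_at_atlas X (U p).
have Dp := nbhs_singleton nD.
pose u := coord c \o U.
pose O := interior (@strip3 R `&` U @^-1` dom c).
have oO : open O by exact: open_interior.
have Op : O p.
  by apply: filterS2 nD (near_map_dom X _ _ CU1 _ _ cp Dp) => q Dq /(_ Dq).
have OD q : O q -> nbhs q (@strip3 R).
  by apply: filterS => z [].
have Oc q : O q -> dom c (U q) by move=> /interior_subset[].
have C2 : Ck_on 2 O u.
  by apply: Ck_on_open oO _ (CU.2 c Ac); exact: interior_subset.
have uc : (coord c @` dom c) (u p) by exact: imageP.
have Df q v (A B : M -> 'M[R]_n) v1 v2 : O q ->
   map_derive X (@strip3 R) U q v =
     A (U q) *m map_derive X (@strip3 R) U q v1 - B (U q) *m map_derive X (@strip3 R) U q v2 ->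
   'D_v f q = form_in_chart X c (alpha A) ('D_v1 u q) (u q)
            - form_in_chart X c (alpha B) ('D_v2 u q) (u q).
  move=> Oq E; have Oq' := OD q Oq; have cq := Oc q Oq.
  rewrite (@derive_val _ _ _ _ _ _ _ (derive_rho X _ _ CU1 rho q v srho Oq')).
  rewrite E /form_in_chart /alpha /u /= coordK//.
  have change w := map_derive_change X _ _ CU1 c q w Ac cq Oq'.
  rewrite -(change v1) -(change v2); exact: differentialB.
have nO : \forall q \near p, O q by exact: open_nbhs_nbhs.
have OS q : O q -> strip3 q by move=> /interior_subset[].
have [] := @laplacian_pairing R _ n (form_in_chart X c (alpha I)) (form_in_chart X c (alpha J))
  (form_in_chart X c (alpha K)) u f O p (e_tau R) (e_s R) (e_t R) oO C2 Op.
- exact: form_linear_near.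
- exact: form_linear_near.
- exact: form_linear_near.
- apply: filterS nO => q Oq; have [E _ _] := fueter_map_derive q (OS q Oq).
  exact: Df.
- apply: filterS nO => q Oq; have [_ E _] := fueter_map_derive q (OS q Oq).
  exact: Df.
- apply: filterS nO => q Oq; have [_ _ E] := fueter_map_derive q (OS q Oq).
  exact: Df.
move=> dt ds dr E; split=> //; rewrite {}E.
(* The chart [c] is the preferred one at [U p], so at [p] itself no coordinate change intervenes. *)
have mE v : map_derive X (@strip3 R) U p v = 'D_v u p.
  by rewrite /map_derive derive_within_interior.
pose A : {linear (R * R * R)%type -> 'cV[R]_n} :=
  triple_map ('D_(e_tau R) u p) ('D_(e_s R) u p) ('D_(e_t R) u p).
have [At As Ar] : [/\ A (e_tau R) = 'D_(e_tau R) u p, A (e_s R) = 'D_(e_s R) u p &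
  A (e_t R) = 'D_(e_t R) u p] := triple_mapE _ _ _.
have AF : quaternion_antilinear I J K (U p) A.
  have := FU p Dp; rewrite !mE /quaternion_antilinear.
  by rewrite -At -As -Ar.
suff H v1 v2 v3 : A (e_tau R) = v1 -> A (e_s R) = v2 -> A (e_t R) = v3 ->
    0 <= ext_pairing (form_in_chart X c (alpha I)) (u p) v2 v3
       + ext_pairing (form_in_chart X c (alpha J)) (u p) v3 v1
       + ext_pairing (form_in_chart X c (alpha K)) (u p) v1 v2.
  exact: H At As Ar.
move=> {}At {}As {}Ar.
(* Convexity speaks of non-zero [A] only; where the differential of [U] vanishes, so do all three
   pairings. *)
have [[a Aa]|/forallNP A0] := pselect (exists a, A a != 0); last first.
  have {}A0 a : A a = 0 by apply/eqP; have /negP := A0 a; rewrite negbK.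
  move: At As Ar; rewrite !A0 => <- <- <-.
  by rewrite !ext_pairingvv !addr0.
have [|l l0 Hl] := cvx A (ex_intro _ a Aa).
  exact: AF.
have := Hl (e_tau R) (e_s R) (e_t R); rewrite At As Ar sigma_frame volume_frame mulr1 => El.
by move: l0; rewrite -El oppr_lt0 => /ltW.
Qed.

End FueterLaplacian.

(** * The Neumann condition *)

Section Lines.
Context {R : realType} {V W : normedModType R} (e p : V).

Definition line (r : R) : V := r *: e + p.

Lemma line_cvg r : line x @[x --> r] --> line r.
Proof. by apply: cvgD; [apply: cvgZr_tmp; exact: cvg_id|exact: cvg_cst]. Qed.

Lemma line_continuous_within {T : topologicalType} (A : set V) (f : V -> T) :
  {within A, continuous f} -> {within line @^-1` A, continuous (f \o line)}.
Proof.
move=> /subspace_continuousP cf; apply/subspace_continuousP => r Ar B fB.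
have H : \forall y \near line r, A y -> B (f y) := cf _ Ar B fB.
exact: (line_cvg r _ H).
Qed.

Lemma quotient_within_line (A : set V) (f : V -> W) r v :
  quotient_within (line @^-1` A) (f \o line) r v = quotient_within A f (line r) (v *: e).
Proof.
have E (h : R) : line (h *: v + r) = h *: (v *: e) + line r.
  by rewrite /line scalerDl scalerA addrA.
rewrite /quotient_within.
rewrite (_ : [set h : R | (line @^-1` A) (h *: v + r)] =
  [set h | A (h *: (v *: e) + line r)]); last first.
  by apply/funext => h /=; rewrite E.
rewrite (_ : (fun h : R => _) = (fun h => h^-1 *: (f (h *: (v *: e) + line r) - f (line r))))//.
by apply/funext => h /=; rewrite E.
Qed.

Lemma Ck_on_line k (A : set V) (f : V -> W) :
  Ck_on k A f -> Ck_on k (line @^-1` A) (f \o line).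
Proof.
elim: k f => [|k IHk] f /= [cf Hf].
  by split=> //; exact: line_continuous_within.
split; first exact: line_continuous_within.
split=> [r v Ar|v].
  by rewrite /derivable_within quotient_within_line; exact: Hf.1.
rewrite (_ : (fun r => _) = (fun y => derive_within A f y (v *: e)) \o line).
  by apply: IHk; exact: Hf.2.
by apply/funext => r; rewrite /derive_within quotient_within_line.
Qed.

End Lines.

(** The curve [U \o line e p] is C^1, defined on all of the real line and contained in [L], as
    [tangent] demands. Lines in the directions of s and t on a wall satisfy the hypotheses. *)
Lemma tangent_line {R : realType} {n : nat} {M : topologicalType} (X : manifold R n M)
    {V : normedModType R} (D : set V) (U : V -> M) (L : set M) (p e : V) :
  Ck_map X D 1 U -> (forall r, D (line e p r)) -> (forall r, L (U (line e p r))) ->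
  tangent X L (U p) (map_derive X D U p e).
Proof.
move=> [cU dU] De Le; exists (U \o line e p).
have ED : line e p @^-1` D = setT by apply/seteqP; split=> // r _; exact: De.
have p0 : line e p 0 = p by rewrite /line scale0r add0r.
split=> //=.
- split; first by rewrite -ED; exact: line_continuous_within.
  move=> c Ac; rewrite (_ : _ `&` _ = line e p @^-1` (D `&` U @^-1` dom c)).
    exact: Ck_on_line (dU c Ac).
  by apply/seteqP; split=> r /= [_ cr]; split=> //; exact: De.
- by rewrite p0.
rewrite /map_derive /= p0 -ED /derive_within.
by rewrite -[coord _ \o (U \o _)]/((coord (chart_at X (U p)) \o U) \o line e p)
  quotient_within_line p0 scale1r.
Qed.

Section NeumannCondition.
Context {R : realType} {n : nat} {M : topologicalType} (X : manifold R n M).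
Context (I J K : M -> 'M[R]_n) (rho : M -> R) (U : R * R * R -> M).
Hypotheses (qIJK : almost_quaternionic X I J K) (srho : smooth_function X rho).
Hypotheses (CU : Ck_map X (@strip3 R) 2 U) (FU : fueter_equation X I J K U).

(** The Fueter equation turns the tau-derivative into the differential of [rho] on [K] and [J]
    applied to the s- and t-derivatives, both tangent to [L] by [tangent_line]. *)
Lemma neumann (L : set M) (tau s t : R) : 0 <= tau <= 1 ->
  (forall s t, L (U (tau, s, t))) ->
  (forall v, tangent X L (U (tau, s, t)) v ->
     differential X rho (U (tau, s, t)) (J (U (tau, s, t)) *m v) = 0 /\
     differential X rho (U (tau, s, t)) (K (U (tau, s, t)) *m v) = 0) ->
  quotient_within (@strip3 R) (rho \o U) (tau, s, t) (e_tau R) --> (0 : R).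
Proof.
move=> tau01 UL JKL; have CU1 := Ck_map_1 _ _ CU.
set p := (tau, s, t); have Dp : strip3 p by [].
have := quotient_rho_cvg X _ _ CU1 rho p (e_tau R) srho Dp.
have [E _ _] := fueter_map_derive _ _ _ _ _ qIJK FU p Dp.
rewrite {}E (differentialB _ _ srho).
have ls r : line (e_s R) p r = (tau, r * 1 + s, r * 0 + t).
  by rewrite -[tau in RHS]add0r -[X in (X + tau, _, _)](mulr0 r).
have lt r : line (e_t R) p r = (tau, r * 0 + s, r * 1 + t).
  by rewrite -[tau in RHS]add0r -[X in (X + tau, _, _)](mulr0 r).
have Ts : tangent X L (U p) (map_derive X (@strip3 R) U p (e_s R)).
  by apply: tangent_line => // r; rewrite ls.
have Tt : tangent X L (U p) (map_derive X (@strip3 R) U p (e_t R)).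
  by apply: tangent_line => // r; rewrite lt.
have [_ Ks] := JKL _ Ts; have [Jt _] := JKL _ Tt.
by rewrite (etrans (congr2 (fun x y : R => x - y) Ks Jt) (subrr _)).
Qed.

End NeumannCondition.

(** * Asymptotics *)

(** Transposition is continuous and carries the closed ball of row vectors, which is bounded and
    closed, onto this one. *)
Lemma closed_ball_cV_compact {R : realType} {n : nat} (y : 'cV[R]_n) (r : R) :
  compact (closed_ball_ (fun z => `|z|) y r).
Proof.
have trK (m k : nat) (v : 'M[R]_(m, k)) : `|v^T| <= `|v|.
  by apply: mx_norm_le => // i j; rewrite mxE mx_norm_coord.
have <- : @trmx R 1 n @` closed_ball_ (fun z => `|z|) (y^T : 'rV[R]_n) r =
    closed_ball_ (fun z => `|z|) y r.
  apply/seteqP; split=> [_ [v vr <-]|v vr] /=.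
    apply: le_trans vr; rewrite -[y in X in X <= _]trmxK -linearB /=; exact: trK.
  exists v^T; last exact: trmxK.
  by rewrite /closed_ball_ /= -linearB /=; apply: le_trans vr; exact: trK.
apply: continuous_compact.
  apply: continuous_subspaceT => v.
  apply/(@cvgrPdist_le R 'cV[R]_n _ (nbhs (v : 'rV[R]_n)) (nbhs_filter _)) => e e0.
  have : \forall w \near (v : 'rV[R]_n), `|v - w| <= e.
    exact: (@cvgr_dist_le R 'rV[R]_n _ (nbhs v) _ id v cvg_id e e0).
  by apply: filterS => w; rewrite -linearB /=; exact: le_trans (trK _ _ _).
apply: bounded_closed_compact; last exact: closed_closed_ball_.
exists (`|y^T| + r); rewrite num_real; split=> // x xr v /= vr.
apply: le_trans (ltW xr); rewrite -lerBlDl; apply: le_trans vr.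
by rewrite distrC; exact: lerB_dist.
Qed.

Section ChartClosenessAndRho.
Context {R : realType} {n : nat} {M : topologicalType} (X : manifold R n M).
Context (rho : M -> R) (srho : smooth_function X rho).

(** Converts closeness in a chart into a comparison of values of [rho]. Here [C] is a coordinate
    ball of half the radius [r] on which [rho] stays within [e / 2] of [rho q], and [d] is the other
    half, so both points lie in the large ball. *)
Lemma chart_close_rho (q : M) (e : R) : 0 < e ->
  exists (c : chart R n M) (C : set M) (d : R),
    [/\ atlas X c, compact C, C `<=` dom c, nbhs q C & 0 < d /\
     forall x y, dom c x -> C y -> `|coord c x - coord c y| < d -> rho x < rho y + e].
Proof.
move=> e0; pose c := chart_at X q.
have cq : dom c q := chart_at_dom X q.
have Ac : atlas X c := chart_at_atlas X q.
have dphi := rho_differentiable _ _ srho _ _ Ac (imageP (coord c) cq).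
have e20 : 0 < e / 2 by rewrite divr_gt0.
have cphi : \forall y \near coord c q, `|rho (point_of c (coord c q)) - rho (point_of c y)| < e / 2.
  by move/differentiable_continuous/cvgrPdist_lt: dphi => /(_ _ e20).
have : \forall y \near coord c q, (coord c @` dom c) y /\
    `|rho (point_of c (coord c q)) - rho (point_of c y)| < e / 2.
  exact: filterI (nbhs_coord_dom _ _ cq) cphi.
move=> /nbhs_ballP[r /= r0 Hr].
have r20 : 0 < r / 2 by rewrite divr_gt0.
pose C' := closed_ball_ (fun z => `|z|) (coord c q) (r / 2).
have Cball y : `|coord c q - y| < r ->
    (coord c @` dom c) y /\ `|rho q - rho (point_of c y)| < e / 2.
  by move=> yr; have := Hr y; rewrite coordK//; apply; rewrite -ball_normE.
have C'r y : C' y -> `|coord c q - y| < r.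
  by rewrite /C' /closed_ball_ /= => H; apply: le_lt_trans H _; lra.
exists c, (point_of c @` C'), (r / 2); split=> //.
- apply: continuous_compact; last exact: closed_ball_cV_compact.
  by apply: continuous_subspaceW (@point_of_continuous _ _ _ c) => y /C'r /Cball[].
- by move=> _ [y /C'r /Cball[cy _] <-]; exact: dom_point_of.
- have : \forall y \near coord c q, C' y.
    apply/nbhs_ballP; exists (r / 2) => // y; rewrite -ball_normE /= => /ltW; exact.
  move=> /(near_coord _ _ _ cq) H; apply: filterS2 (nbhs_dom _ _ cq) H => x cx C'x.
  by exists (coord c x) => //; rewrite coordK.
split=> // x _ cx [y C'y <-].
have [cy Hy] := Cball _ (C'r _ C'y); rewrite (point_ofK c y cy) => xy.
have := Cball (coord c x); rewrite coordK//.
have xr : `|coord c q - coord c x| < r.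
  apply: le_lt_trans (ler_distD y _ _) _; rewrite [r]splitr.
  by apply: ler_ltD => //; rewrite distrC.
move=> /(_ xr) [_]; move: Hy; rewrite !ltr_distlC => /andP[h1 h2] /andP[h3 h4]; lra.
Qed.

Lemma cvg_C1_loc_rho (D B : set (R * R)) (F : R -> R * R -> M) (Phi : set_system R)
    (q : M) (e : R) : ProperFilter Phi -> 0 < e ->
  cvg_C1_loc X D F Phi (fun=> q) -> compact B -> B `<=` D ->
  \forall r \near Phi, forall z, B z -> rho (F r z) < rho q + e.
Proof.
move=> PF e0 FG cB BD; have [c [C [d [Ac cC Cc qC [d0 Hd]]]]] := chart_close_rho q e e0.
apply: filterS (FG B cB BD c C d Ac cC Cc d0) => r H z Bz.
have [cz Fz _] := H z Bz (nbhs_singleton qC).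
by apply: Hd => //; exact: nbhs_singleton.
Qed.

Lemma cvg_C1_rho_nbhs (D : set (R * R)) (F : R -> R * R -> M) (Phi : set_system R)
    (G : R * R -> M) (q : M) (e : R) : ProperFilter Phi -> 0 < e ->
  cvg_C1 X D F Phi G ->
  exists2 N, nbhs q N & \forall r \near Phi, forall z, D z -> N (G z) ->
     rho (F r z) < rho (G z) + e.
Proof.
move=> PF e0 FG; have [c [C [d [Ac cC Cc qC [d0 Hd]]]]] := chart_close_rho q e e0.
exists C => //; apply: filterS (FG c C d Ac cC Cc d0) => r H z Dz Cz.
have [cz Fz _] := H z Dz Cz; exact: Hd.
Qed.

(** Near each point of [Q] the values of [rho] along [F] exceed those along [G] by less than 1;
    compactness of [Q] makes one threshold work everywhere, and [rho \o G] attains a maximum on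
    [Q]. *)
Lemma cvg_C1_rho_compact (D Q : set (R * R)) (F : R -> R * R -> M) (Phi : set_system R)
    (G : R * R -> M) : ProperFilter Phi ->
  cvg_C1 X D F Phi G -> {within D, continuous G} -> compact Q -> Q `<=` D ->
  exists B, \forall r \near Phi, forall z, Q z -> rho (F r z) < B.
Proof.
move=> PF FG cG cQ QD.
have cGQ := continuous_subspaceW QD cG.
have crG : {within Q, continuous (rho \o G)}.
  by refine (@within_continuous_comp _ _ _ Q G rho _ cGQ) => z _; exact: (rho_continuous X).
have [->|/set0P Q0] := eqVneq Q set0.
  by exists 0; apply: nearW => r z [].
have [z0 _ z0max] := compact_EVT_max Q0 cQ crG.
exists (rho (G z0) + 1).
have H : \forall r \near Phi, Q `<=` (fun z => D z -> rho (F r z) < rho (G z) + 1).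
  move/compact_near_coveringP: cQ; apply=> z Qz.
  have [N GN HN] := cvg_C1_rho_nbhs D F Phi G (G z) 1 PF ltr01 FG.
  move/subspace_continuousP: cG => /(_ z (QD _ Qz) N GN) nN.
  exists ([set z' | D z' -> N (G z')], [set r | forall z, D z -> N (G z) ->
     rho (F r z) < rho (G z) + 1]); first by split.
  by case=> z' r [/= Hz Hr Dz']; apply: Hr => //; exact: Hz.
apply: filterS H => r H z Qz; apply: lt_le_trans (H z Qz (QD z Qz)) _.
by rewrite lerD2r; apply: z0max; rewrite inE.
Qed.

Context (L0 L1 : set M) (J : M -> 'M[R]_n) (r : R).
Hypothesis rho_r : forall x, L0 x -> L1 x -> rho x <= r.

(** For large [t] of either sign, [u] is near [p] or [q], where [rho] is below [r + e / 2]; the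
    other [e / 2] pays for the passage from [u] to [F s]. The bound [T] comes from [u] alone, hence
    is uniform in [s]. *)
Lemma antiholomorphic_strip_bound (p q : M) (u : R * R -> M) (F : R -> R * R -> M)
    (Phi : set_system R) (e : R) : ProperFilter Phi -> 0 < e ->
  (L0 `&` L1) p -> (L0 `&` L1) q -> antiholomorphic_strip X J L0 L1 p q u ->
  cvg_C1 X (@strip_t_tau R) F Phi u ->
  exists T : R, \forall s \near Phi, forall t tau, 0 <= tau <= 1 ->
    T <= `|t| -> rho (F s (t, tau)) < r + e.
Proof.
move=> PF e0 [L0p L1p] [L0q L1q] [_ _ _ up uq] Fu.
have e20 : 0 < e / 2 by rewrite divr_gt0.
have [Np pN Hp] := cvg_C1_rho_nbhs _ _ _ _ p _ PF e20 Fu.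
have [Nq qN Hq] := cvg_C1_rho_nbhs _ _ _ _ q _ PF e20 Fu.
have rho_near x : L0 x -> L1 x -> \forall y \near x, rho y < r + e / 2.
  move=> L0x L1x.
  have /cvgrPdist_lt /(_ _ e20) := rho_continuous _ _ srho x.
  by apply: filterS => y; rewrite ltr_distlC => /andP[_ ?]; have := rho_r x L0x L1x; lra.
have [a [_ Ha]] := up _ (filterI pN (rho_near p L0p L1p)).
have [b [_ Hb]] := uq _ (filterI qN (rho_near q L0q L1q)).
(* Neighbourhoods of infinity are given by strict inequalities; the margin 1 turns [T <=] into
   them. *)
exists (Num.max (1 - a) (b + 1)); apply: filterS2 Hp Hq => s Hp Hq t tau tau01.
rewrite ge_max => /andP[ta tb]; have [t0|t0] := lerP 0 t.
  have [|Nu ru] := Hb t _ tau tau01; first by move: tb; rewrite ger0_norm//; lra.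
  by have := Hq (t, tau) tau01 Nu; lra.
have [|Nu ru] := Ha t _ tau tau01; first by move: ta; rewrite ltr0_norm//; lra.
by have := Hp (t, tau) tau01 Nu; lra.
Qed.

(** The order of choice matters. First [S1], beyond which [U] is close enough to the limit strips;
    then [T], large enough for the limits in t to be uniform over [s] in [[- S1, S1]]; finally [S]
    and [B], from the limit strips over the compact set of [t] in [[- T, T]]. In that last region
    the limit strips may exceed [r], whence only the bound [B]. *)
Lemma fueter_asymptotics_bound (U : R * R * R -> M) (e : R) : 0 < e ->
  fueter_asymptotics X J L0 L1 U ->
  exists (T S B : R),
    (forall tau s t, 0 <= tau <= 1 -> T <= `|t| -> rho (U (tau, s, t)) <= r + e) /\
    (forall tau s t, 0 <= tau <= 1 -> S <= `|s| -> `|t| <= T ->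
       rho (U (tau, s, t)) <= B).
Proof.
move=> e0 [pm [pp [um [up]]]] [[Lm Lp] [hm hp] [cm cp] [lm lp]].
have [Tm Hm] := antiholomorphic_strip_bound _ _ _ _ _ _ _ e0 Lm Lp hm cm.
have [Tp Hp] := antiholomorphic_strip_bound _ _ _ _ _ _ _ e0 Lm Lp hp cp.
have [am [_ Ham]] := Hm; have [ap [_ Hap]] := Hp.
pose S1 := Num.max (1 - am) (ap + 1).
have HS1 tau s t : 0 <= tau <= 1 -> S1 <= `|s| -> Num.max Tm Tp <= `|t| ->
    rho (U (tau, s, t)) <= r + e.
  rewrite !ge_max => tau01 /andP[s1 s2] /andP[t1 t2]; apply: ltW; have [s0|s0] := lerP 0 s.
    by apply: (Hap s _ t tau) => //; move: s2; rewrite ger0_norm//; lra.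
  by apply: (Ham s _ t tau) => //; move: s1; rewrite ltr0_norm//; lra.
pose Bx := `[0 : R, 1] `*` `[- S1, S1].
have cBx : compact Bx by apply: compact_setX; exact: segment_compact.
have Bxs : Bx `<=` @strip_tau_s R by move=> z [/= + _]; rewrite in_itv.
have [bm [_ Hbm]] := cvg_C1_loc_rho _ _ _ _ _ e _ e0 lm cBx Bxs.
have [bp [_ Hbp]] := cvg_C1_loc_rho _ _ _ _ _ e _ e0 lp cBx Bxs.
pose T := Num.max (Num.max Tm Tp) (Num.max (1 - bm) (bp + 1)).
pose Qx := `[- T, T] `*` `[0 : R, 1].
have cQx : compact Qx by apply: compact_setX; exact: segment_compact.
have Qxs : Qx `<=` @strip_t_tau R by move=> z [/= _]; rewrite in_itv.
have [[cum _] _ _ _ _] := hm; have [[cup _] _ _ _ _] := hp.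
have [Bm [sm [_ HBm]]] := cvg_C1_rho_compact _ _ _ _ _ _ cm cum cQx Qxs.
have [Bp [sp [_ HBp]]] := cvg_C1_rho_compact _ _ _ _ _ _ cp cup cQx Qxs.
exists T, (Num.max (1 - sm) (sp + 1)), (Num.max Bm Bp); split=> tau s t tau01.
  rewrite !ge_max => /andP[/andP[t1 t2] /andP[t3 t4]].
  have [s1|/ltW s1] := lerP S1 `|s|; first by apply: HS1 => //; rewrite ge_max t1 t2.
  have Bz : Bx (tau, s) by split; rewrite /= in_itv//= -ler_norml.
  have rhop x : (L0 `&` L1) x -> rho x + e <= r + e.
    by move=> [? ?]; rewrite lerD2r; exact: rho_r.
  have [t0|t0] := lerP 0 t.
    apply: le_trans (ltW (Hbp t _ (tau, s) Bz)) (rhop _ Lp).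
    by move: t4; rewrite ger0_norm//; lra.
  apply: le_trans (ltW (Hbm t _ (tau, s) Bz)) (rhop _ Lm).
  by move: t3; rewrite ltr0_norm//; lra.
rewrite ge_max => /andP[s1 s2] tT.
have Qz : Qx (t, tau) by split; rewrite /= in_itv//= -ler_norml.
rewrite le_max; apply/orP; have [s0|s0] := lerP 0 s.
  right; apply/ltW/(HBp s _ (t, tau)) => //.
  by move: s2; rewrite ger0_norm//; lra.
left; apply/ltW/(HBm s _ (t, tau)) => //.
by move: s1; rewrite ltr0_norm//; lra.
Qed.

End ChartClosenessAndRho.

(** * A maximum principle on the strip *)

Lemma strip3_nbhs {R : realType} (p : R * R * R) : 0 < p.1.1 < 1 -> nbhs p (@strip3 R).
Proof.
move=> /andP[p0 p1].
have c1 : (q.1.1 @[q --> p]) --> (p.1.1 : R).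
  by apply: (@cvg_comp _ _ _ fst fst _ (nbhs p.1)); exact: cvg_fst.
have n0 : \forall x \near p.1.1, 0 <= x <= 1.
  by near=> x; apply/andP; split; apply/ltW; near: x; [exact: lt_nbhsr|exact: lt_nbhsl].
exact: (c1 _ n0).
Unshelve. all: by end_near. Qed.

Lemma near_unit_interval {R : realType} (tau : R) : 0 < tau < 1 ->
  \forall h \near (0 : R), 0 <= h + tau <= 1.
Proof.
move=> /andP[tau0 tau1].
have nh : \forall h \near (0 : R), - tau < h < 1 - tau.
  near=> h; apply/andP; split; near: h; [apply: lt_nbhsr|apply: lt_nbhsl]; lra.
by apply: filterS nh => h /andP[h1 h2]; apply/andP; split; lra.
Unshelve. all: by end_near. Qed.

Lemma compact_box {R : realType} (S T : R) : exists2 Q : set (R * R * R), compact Q &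
  forall tau s t, Q (tau, s, t) = [/\ 0 <= tau <= 1, `|s| <= S & `|t| <= T].
Proof.
exists ((`[0 : R, 1] `*` `[- S, S]) `*` `[- T, T]).
  by do 2?apply: compact_setX; exact: segment_compact.
move=> tau s t; rewrite /= !in_itv /= -!ler_norml; apply/propext.
by split=> [[[]]|[]].
Qed.

(** * Inequalities and constants for the barrier function *)

Section BarrierArithmetic.
Context {R : realType}.
Implicit Types (F G a b c eps del eta h k tau s t : R).

(** Expanding the barrier in [h] yields the constants [a] and [b] of [second_derivative_le]; the
    next two lemmas do the same for s and t. *)
Lemma barrier_tau F G a b eta h tau :
  F + a - b + eta * ((h + tau) * (1 - (h + tau))) <= G + a - b + eta * (tau * (1 - tau)) ->
  F + - eta * h ^+ 2 + eta * (1 - 2 * tau) * h <= G.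
Proof. by nra. Qed.

Lemma barrier_s F G a b del h s :
  F + a - del * (h + s) ^+ 2 + b <= G + a - del * s ^+ 2 + b ->
  F + - del * h ^+ 2 + - 2 * del * s * h <= G.
Proof. by nra. Qed.

Lemma barrier_t F G a b eps h t :
  F + eps * (h + t) ^+ 2 - a + b <= G + eps * t ^+ 2 - a + b ->
  F + eps * h ^+ 2 + 2 * eps * t * h <= G.
Proof. by nra. Qed.

(** A step [k] inward from the wall raises the barrier term by [eta * k * (1 - k)], more than
    [eta / 2 * k] because [k < 1 / 2], while [f] drops by less than [eta / 2 * k]. *)
Lemma barrier_left F G a b eta k : 0 < k -> k < 1 / 2 -> 0 < eta ->
  - (eta / 2 * k) < F - G ->
  F + a - b + eta * (k * (1 - k)) <= G + a - b + eta * (0 * (1 - 0)) -> False.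
Proof.
move=> k0 k2 eta0; have : 0 < eta * k * (1 / 2 - k) by rewrite !mulr_gt0// subr_gt0.
by nra.
Qed.

Lemma barrier_right F G a b eta k : 0 < k -> k < 1 / 2 -> 0 < eta ->
  - (eta / 2 * k) < F - G ->
  F + a - b + eta * ((- k + 1) * (1 - (- k + 1))) <= G + a - b + eta * (1 * (1 - 1)) -> False.
Proof.
move=> k0 k2 eta0; have : 0 < eta * k * (1 / 2 - k) by rewrite !mulr_gt0// subr_gt0.
by nra.
Qed.

Lemma barrier_compare (r e del s b0 b F : R) : 0 <= del -> b0 <= b ->
  r + 3 * e < b0 -> b <= F - del * s ^+ 2 + 2 * e -> r + e < F.
Proof. by move=> del0; have := mulr_ge0 del0 (sqr_ge0 s); lra. Qed.

Lemma barrier_far (r e del s S B b0 b F : R) : 0 < e -> `|s| = S ->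
  B - del * S ^+ 2 <= r -> F <= B -> b0 <= b ->
  r + 3 * e < b0 -> b <= F - del * s ^+ 2 + 2 * e -> False.
Proof. by move=> e0 <-; rewrite real_normK ?num_real//; lra. Qed.

Lemma near_abs_le (x y : R) : `|x| < y -> \forall h \near (0 : R), `|h + x| <= y.
Proof.
move=> xy; have yx : 0 < y - `|x| by rewrite subr_gt0.
have := @nbhs0_lt R R _ yx; apply: filterS => h hy.
by apply: le_trans (ler_normD _ _) _; rewrite -lerBrDr; exact: ltW.
Qed.

Lemma barrier_laplacian eps del eta : eta + del < eps ->
  0 <= - 2 * - eta + - 2 * - del + - 2 * eps -> False.
Proof. by lra. Qed.

Lemma small_positive (d : R) : 0 < d -> exists k : R,
  [/\ 0 < k, k < d, k < 1 / 2, 0 <= k <= 1 & 0 <= - k + 1 <= 1].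
Proof.
move=> d0; have m0 : 0 < Num.min d (1 / 2) by rewrite lt_min d0; lra.
have md : Num.min d (1 / 2) <= d by rewrite ge_min lexx.
have m2 : Num.min d (1 / 2) <= 1 / 2 by rewrite ge_min lexx orbT.
by exists (Num.min d (1 / 2) / 2); split; try (apply/andP; split); lra.
Qed.

(** [eps] is bounded through [T]; [eta] is a quarter of [eps] and [del] at most that, so their sum
    stays below [eps]; [del] is also small relative to [s0 ^+ 2]. Finally [S'] makes [del * S'] at
    least the distance from [B] to [r], and [S' >= 1] passes this on to [S' ^+ 2]. *)
Lemma barrier_constants (e T S B s0 r : R) : 0 < e -> exists eps del eta S' : R,
  [/\ 0 < eta, 0 < del & eta + del < eps] /\
  [/\ S <= S', `|s0| < S', del * s0 ^+ 2 < e & B - del * S' ^+ 2 <= r] /\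
  eps * T ^+ 2 <= e /\ eta <= e.
Proof.
move=> e0; pose eps := e / (T ^+ 2 + 1).
have T1 : 0 < T ^+ 2 + 1 by rewrite ltr_wpDl// sqr_ge0.
have s1 : 0 < s0 ^+ 2 + 1 by rewrite ltr_wpDl// sqr_ge0.
have eps0 : 0 < eps by rewrite divr_gt0.
have epsE : eps * T ^+ 2 + eps = e by rewrite -[X in _ + X]mulr1 -mulrDr divfK// gt_eqF.
have epsT : 0 <= eps * T ^+ 2 by rewrite mulr_ge0 ?sqr_ge0// ltW.
pose del := eps / 4 / (s0 ^+ 2 + 1).
have del0 : 0 < del by rewrite !divr_gt0.
have delE : del * s0 ^+ 2 + del = eps / 4 by rewrite -[X in _ + X]mulr1 -mulrDr divfK// gt_eqF.
have dels : 0 <= del * s0 ^+ 2 by rewrite mulr_ge0 ?sqr_ge0// ltW.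
have k0 : 0 <= `|B - r| / del by rewrite divr_ge0// ltW.
exists eps, del, (eps / 4), (`|S| + `|s0| + 1 + `|B - r| / del).
split; first by split; lra.
have := ler_norm S; have := normr_ge0 S; have := normr_ge0 s0 => h1 h2 h3.
split; last by split; lra.
split; [lra|lra|lra|].
set S' := _ + _ + _ + _; have S'1 : 1 <= S' by rewrite /S'; lra.
have delS : `|B - r| <= del * S'.
  rewrite mulrC -ler_pdivrMr// /S'; lra.
have : del * S' <= del * S' ^+ 2.
  by rewrite ler_wpM2l ?(ltW del0)// expr2 ler_peMl//; lra.
have := ler_norm (B - r); lra.
Qed.

Lemma barrier_upper F eps del eta e T tau s t : 0 < eta -> 0 < eps ->
  eps * T ^+ 2 <= e -> eta <= e -> 0 <= tau <= 1 -> `|t| <= T ->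
  F + eps * t ^+ 2 - del * s ^+ 2 + eta * (tau * (1 - tau)) <= F - del * s ^+ 2 + 2 * e.
Proof.
move=> eta0 eps0 epsT etae /andP[tau0 tau1] tT.
have : eps * t ^+ 2 <= eps * T ^+ 2.
  rewrite ler_wpM2l ?(ltW eps0)// -real_normK ?num_real// lerXn2r ?nnegrE//.
  exact: le_trans tT.
have : eta * (tau * (1 - tau)) <= eta by rewrite ler_piMr ?(ltW eta0)//; nra.
lra.
Qed.

Lemma barrier_lower F eps del eta e r tau s t : 0 < eta -> 0 < eps ->
  F = r + 4 * e -> del * s ^+ 2 < e -> 0 <= tau <= 1 ->
  r + 3 * e < F + eps * t ^+ 2 - del * s ^+ 2 + eta * (tau * (1 - tau)).
Proof.
move=> eta0 eps0 -> dels /andP[tau0 tau1].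
have : 0 <= eps * t ^+ 2 by rewrite mulr_ge0 ?sqr_ge0// ltW.
have : 0 <= eta * (tau * (1 - tau)) by rewrite !mulr_ge0 ?subr_ge0// ltW.
lra.
Qed.

End BarrierArithmetic.

Section NeumannMaximumPrinciple.
Context {R : realType} (f : R * R * R -> R) (r : R).
Hypothesis f_cont : {within @strip3 R, continuous f}.
Hypothesis f_diff : forall p v : R * R * R, nbhs p (@strip3 R) -> derivable f p v.
Hypothesis f_sub : forall p : R * R * R, nbhs p (@strip3 R) -> r < f p ->
  [/\ derivable ('D_(e_tau R) f) p (e_tau R), derivable ('D_(e_s R) f) p (e_s R),
      derivable ('D_(e_t R) f) p (e_t R) &
  0 <= 'D_(e_tau R) ('D_(e_tau R) f) p + 'D_(e_s R) ('D_(e_s R) f) p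
       + 'D_(e_t R) ('D_(e_t R) f) p].
Hypothesis f_neumann : forall tau s t, tau = 0 \/ tau = 1 -> r < f (tau, s, t) ->
  quotient_within (@strip3 R) f (tau, s, t) (e_tau R) --> (0 : R).

Let triple_line (h a b c x y z : R) :
  h *: ((a, b, c) : R * R * R) + (x, y, z) = (h * a + x, h * b + y, h * c + z).
Proof. by []. Qed.

Let line_tau (h tau s t : R) : h *: e_tau R + (tau, s, t) = (h + tau, s, t).
Proof. by rewrite /e_tau triple_line !mulr0 mulr1 !add0r. Qed.

Let line_s (h tau s t : R) : h *: e_s R + (tau, s, t) = (tau, h + s, t).
Proof. by rewrite /e_s triple_line !mulr0 mulr1 !add0r. Qed.

Let line_t (h tau s t : R) : h *: e_t R + (tau, s, t) = (tau, s, h + t).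
Proof. by rewrite /e_t triple_line !mulr0 mulr1 !add0r. Qed.

(* [eps], [del], [eta] weigh the confinement in [t], in [s], and the strict
   inward slope at the two walls. *)
Let barrier (eps del eta : R) (p : R * R * R) : R :=
  f p + eps * p.2 ^+ 2 - del * p.1.2 ^+ 2 + eta * (p.1.1 * (1 - p.1.1)).

Lemma barrier_continuous (Q : set (R * R * R)) (eps del eta : R) :
  {within Q, continuous f} -> {within Q, continuous (barrier eps del eta)}.
Proof.
move=> /subspace_continuousP cf; apply/subspace_continuousP => x Qx.
pose F := within Q (nbhs x); have FF : Filter F by exact: within_filter.
have c2 : (q.2 : R) @[q --> F] --> x.2 by apply: cvg_within_filter; exact: cvg_snd.
have c1 : q.1 @[q --> F] --> x.1 by apply: cvg_within_filter; exact: cvg_fst.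
have c11 : (q.1.1 : R) @[q --> F] --> x.1.1 by apply: cvg_comp c1 _; exact: cvg_fst.
have c12 : (q.1.2 : R) @[q --> F] --> x.1.2 by apply: cvg_comp c1 _; exact: cvg_snd.
apply: cvgD; last first.
  by apply: cvgM; [exact: cvg_cst|apply: cvgM => //; apply: cvgB => //; exact: cvg_cst].
apply: cvgB; last by apply: cvgM; [exact: cvg_cst|rewrite expr2; apply: cvgM].
apply: cvgD; first exact: cf.
by apply: cvgM; [exact: cvg_cst|rewrite expr2; apply: cvgM].
Qed.

(** At an interior maximum of the barrier the pure second derivatives of [f] sum to at most
    [2 * (eta + del - eps) < 0], against subharmonicity. On a wall the slope of the eta-term points
    inward and dominates the vanishing normal derivative of [f]. *)
Lemma no_local_max (eps del eta tau s t : R) : 0 < eta -> 0 < eps -> eta + del < eps ->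
  0 <= tau <= 1 -> r < f (tau, s, t) ->
  (\forall h \near (0 : R), [/\ (0 <= h + tau <= 1 ->
      barrier eps del eta (h + tau, s, t) <= barrier eps del eta (tau, s, t)),
     barrier eps del eta (tau, h + s, t) <= barrier eps del eta (tau, s, t) &
     barrier eps del eta (tau, s, h + t) <= barrier eps del eta (tau, s, t)]) ->
  False.
Proof.
move=> eta0 eps0 etadel tau01 rf nmax; set p := (tau, s, t).
have [tau_in|tau_bd] := boolP (0 < tau < 1).
  have nD : nbhs p (@strip3 R) by exact: strip3_nbhs.
  have df v : \forall y \near p, derivable f y v.
    by apply: filterS (nbhs_interior nD) => y; exact: f_diff.
  have [d1 d2 d3 lap] := f_sub p nD rf.
  have l1 : 'D_(e_tau R) ('D_(e_tau R) f) p <= - 2 * - eta.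
    apply: (second_derivative_le f p (e_tau R) (- eta) (eta * (1 - 2 * tau)) (df _) d1).
    apply: filterS2 nmax (near_unit_interval tau tau_in) => h [H _ _] /H.
    by rewrite line_tau; exact: barrier_tau.
  have l2 : 'D_(e_s R) ('D_(e_s R) f) p <= - 2 * - del.
    apply: (second_derivative_le f p (e_s R) (- del) (- 2 * del * s) (df _) d2).
    apply: filterS nmax => h [_ H _]; 
    by rewrite line_s; exact: barrier_s H.
  have l3 : 'D_(e_t R) ('D_(e_t R) f) p <= - 2 * eps.
    apply: (second_derivative_le f p (e_t R) eps (2 * eps * t) (df _) d3).
    apply: filterS nmax => h [_ _ H]; 
    by rewrite line_t; exact: barrier_t H.
  exact: barrier_laplacian etadel (le_trans lap (lerD (lerD l1 l2) l3)).
have tau_b : tau = 0 \/ tau = 1.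
  move: tau01 tau_bd => /andP[]; rewrite !le_eqVlt => /orP[/eqP <-|->]; first by left.
  by move=> /orP[/eqP ->|->]; [right|].
(* Half of the inward slope [eta] of the barrier term at the walls; the inward step is [k] at
   [tau = 0] and [- k] at [tau = 1]. *)
have eta20 : 0 < eta / 2 by rewrite divr_gt0.
have /cvgrPdist_lt /(_ _ eta20) := f_neumann tau s t tau_b rf.
rewrite near_withinE near_withinE => nq.
have /nbhs_ballP[d /= d0 Hd] : \forall h \near (0 : R),
  (h != 0 -> 0 <= h + tau <= 1 -> `|h^-1 * (f (h + tau, s, t) - f (tau, s, t))| < eta / 2) /\
  (0 <= h + tau <= 1 ->
      barrier eps del eta (h + tau, s, t) <= barrier eps del eta (tau, s, t)).
  apply: filterS2 nq nmax => h Hq [H _ _]; split=> // h0 ht.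
  have := Hq h0; rewrite /= !line_tau => /(_ ht); rewrite sub0r normrN; exact.
have [k [k0 kd k2 k01 k01']] := small_positive d d0.
case: tau_b => tauE.
  have [|+ H2] := Hd k; first by rewrite -ball_normE /= sub0r normrN gtr0_norm.
  rewrite gt_eqF// tauE addr0 => /(_ isT) H1.
  have := H1 k01; have := H2; rewrite tauE addr0 => /(_ k01).
  rewrite normrM normfV (gtr0_norm k0) mulrC ltr_pdivrMr// ltr_norml.
  by move=> Hb /andP[Hf _]; exact: barrier_left k0 k2 eta0 Hf Hb.
have [|+ H2] := Hd (- k); first by rewrite -ball_normE /= sub0r opprK gtr0_norm.
rewrite oppr_eq0 gt_eqF// tauE => /(_ isT) H1.
have := H1 k01'; have := H2; rewrite tauE => /(_ k01').
rewrite normrM normfV normrN (gtr0_norm k0) mulrC ltr_pdivrMr// ltr_norml.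
by move=> Hb /andP[Hf _]; exact: barrier_right k0 k2 eta0 Hf Hb.
Unshelve. all: by end_near. Qed.

Hypothesis f_infty : forall e : R, 0 < e -> exists (T S B : R),
  (forall tau s t, 0 <= tau <= 1 -> T <= `|t| -> f (tau, s, t) <= r + e) /\
  (forall tau s t, 0 <= tau <= 1 -> S <= `|s| -> `|t| <= T -> f (tau, s, t) <= B).

(** If [f] exceeded [r] somewhere, the barrier would attain its maximum over a compact box off the
    faces in s and t, still with [f > r] there, contradicting [no_local_max]. *)
Lemma neumann_max_principle p : strip3 p -> f p <= r.
Proof.
case: p => -[tau0 s0] t0 tau0_in; rewrite leNgt; apply/negP => rf.
(* The excess is cut into four: the perturbation lowers the value at the starting point by less than
   [e] and raises [f] by at most [2 * e] on the box, so [f] stays above [r + e] at the maximum. *)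
have [e e0 fe] : exists2 e : R, 0 < e & f (tau0, s0, t0) = r + 4 * e.
  by exists ((f (tau0, s0, t0) - r) / 4); lra.
have [T [S [B [fT fS]]]] := f_infty e e0.
have [eps [del [eta [S' [[eta0 del0 etadel] [[SS' s0S' dels0 far] [epsT etae]]]]]]] :=
  barrier_constants e T S B s0 r e0.
have eps0 : 0 < eps by exact: lt_trans (addr_gt0 eta0 del0) etadel.
have tT : `|t0| < T.
  rewrite ltNge; apply/negP => /(fT tau0 s0 t0 tau0_in).
  by rewrite fe leNgt ltrD2l ltr_pMl// ltr1n.
have [Q cQ QE] := compact_box S' T.
have Qp0 : Q (tau0, s0, t0) by rewrite QE; split=> //; exact: ltW.
have cb : {within Q, continuous (barrier eps del eta)}.
  apply: barrier_continuous; apply: continuous_subspaceW f_cont.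
  by case=> -[tau s] t; rewrite QE => -[].
have [[[tau s] t]] := compact_EVT_max (ex_intro _ _ Qp0) cQ cb.
rewrite inE QE => -[tau_in sS tT'] bmax.
have b0 : barrier eps del eta (tau0, s0, t0) <= barrier eps del eta (tau, s, t).
  by apply: bmax; rewrite inE.
have f_big : r + e < f (tau, s, t).
  have := barrier_upper (f (tau, s, t)) _ del _ _ _ tau s _ eta0 eps0 epsT etae tau_in tT'.
  have := barrier_lower _ _ _ _ _ _ _ s0 t0 eta0 eps0 fe dels0 tau0_in.
  exact: barrier_compare (ltW del0) b0.
have tT'' : `|t| < T.
  by rewrite ltNge; apply/negP => /(fT tau s t tau_in); rewrite leNgt f_big.
(* On the faces [|s| = S'] the penalty [del * S' ^+ 2] brings the bound [B] down to [r], too low for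
   a maximum. *)
have sS'' : `|s| < S'.
  rewrite lt_neqAle sS andbT; apply/eqP => sE.
  have fB : f (tau, s, t) <= B by apply: fS tT' => //; rewrite sE.
  have := barrier_upper (f (tau, s, t)) _ del _ _ _ tau s _ eta0 eps0 epsT etae tau_in tT'.
  have := barrier_lower _ _ _ _ _ _ _ s0 t0 eta0 eps0 fe dels0 tau0_in.
  exact: barrier_far e0 sE far fB b0.
apply: (no_local_max eps del eta tau s t eta0 eps0 etadel tau_in).
  by apply: lt_trans f_big; rewrite ltrDl.
have ns : \forall h \near (0 : R), `|h + s| <= S' by exact: near_abs_le.
have nt : \forall h \near (0 : R), `|h + t| <= T by exact: near_abs_le.
apply: filterS2 ns nt => h hs ht.
split=> [htau||]; apply: bmax; rewrite inE QE; split=> //; exact: ltW.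
Qed.

End NeumannMaximumPrinciple.

(** * Compactness *)

Lemma compact_le {R : realType} {T : topologicalType} (g : T -> R) (C : set T) :
  continuous g -> compact C -> exists b, forall x, C x -> g x <= b.
Proof.
move=> cg cC; have [->|/set0P C0] := eqVneq C set0; first by exists 0.
have [x0 _ x0max] := compact_EVT_max C0 cC (continuous_subspaceT cg).
by exists (g x0) => x Cx; apply: x0max; rewrite inE.
Qed.

(** Treats both kinds of boundary alike: for compact [L] the exceptional set is [L] itself, and the
    condition outside it is vacuous. *)
Lemma JK_conical_outside {R : realType} {n : nat} {M : topologicalType}
    (X : manifold R n M) (J K : M -> 'M[R]_n) (rho : M -> R) (L : set M) :
  compact L \/ JK_conical X J K rho L ->
  exists2 C : set M, compact C & forall x, L x -> ~ C x ->
    forall v, tangent X L x v ->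
      differential X rho x (J x *m v) = 0 /\ differential X rho x (K x *m v) = 0.
Proof.
case=> [cL|[C cC HC]]; first by exists L.
by exists C => // x Lx Cx; have [] := HC x Lx Cx.
Qed.

Theorem theorem1p9 (R : realType) (n : nat) (M : topologicalType)
    (X : manifold R n M) (I J K : M -> 'M[R]_n) (rho : M -> R)
    (L0 L1 : set M) :
  almost_quaternionic X I J K ->
  IJK_conical_end X I J K rho ->
  submanifold X L0 -> submanifold X L1 ->
  totally_real X J L0 -> totally_real X K L0 ->
  totally_real X J L1 -> totally_real X K L1 ->
  compact L0 \/ JK_conical X J K rho L0 ->
  compact L1 \/ JK_conical X J K rho L1 ->
  compact (L0 `&` L1) ->
  exists2 M0 : set M, compact M0 &
    forall U : R * R * R -> M, fueter_strip X I J K L0 L1 U ->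
      forall p, strip3 p -> M0 (U p).
Proof.
move=> qIJK [_ [srho proper_rho] [C cC convex_end]] _ _ _ _ _ _ con0 con1 cL.
have [C0 cC0 tan0] := JK_conical_outside _ _ _ _ _ con0.
have [C1 cC1 tan1] := JK_conical_outside _ _ _ _ _ con1.
have crho := rho_continuous X rho srho.
(* The level [r] is chosen before [U]. Above it [rho] is convex and the boundary conditions are
   conical, and the limit points in [L0]&[L1] lie at or below it; its sublevel set is compact
   because [rho] is exhausting. *)
have [r rP] := compact_le rho _ crho (compactU (compactU cC cC0) (compactU cC1 cL)).
have out x A : A `<=` (C `|` C0) `|` (C1 `|` (L0 `&` L1)) -> r < rho x -> ~ A x.
  by move=> AC rx Ax; have := rP x (AC _ Ax); rewrite leNgt rx.
exists [set x | rho x <= r]; first exact: proper_rho.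
move=> U [CU FU UL _ asym] p Dp; have CU1 := Ck_map_1 _ _ CU.
have frho : {within @strip3 R, continuous (rho \o U)}.
  exact: (@within_continuous_comp _ _ _ (@strip3 R) U rho (fun z _ => crho z) CU.1).
suff fp : (rho \o U) p <= r by exact: fp.
apply: (@neumann_max_principle R (rho \o U) r) => //.
- by move=> q v /(derive_rho X _ _ CU1 rho q v srho) /@ex_derive.
- move=> q nq rq; apply: (laplacian_ge0 X I J K) => //.
  have [+ _] := convex_end (U q) (out _ _ (fun x Cx => or_introl (or_introl Cx)) rq).
  exact.
- move=> tau s t [->|->] rq.
    apply: (neumann X I J K rho U qIJK srho CU FU L0) => //.
    + by rewrite lexx ler01.
    + by move=> s' t'; have [] := UL s' t'.
    + apply: tan0; first by have [] := UL s t.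
      exact: (out _ _ (fun x Cx => or_introl (or_intror Cx)) rq).
  apply: (neumann X I J K rho U qIJK srho CU FU L1) => //.
  + by rewrite lexx ler01.
  + by move=> s' t'; have [] := UL s' t'.
  + apply: tan1; first by have [] := UL s t.
    exact: (out _ _ (fun x Cx => or_intror (or_introl Cx)) rq).
move=> e e0.
have [T [S [B [HT HS]]]] := fueter_asymptotics_bound X rho srho L0 L1 J r
  (fun x L0x L1x => rP x (or_intror (or_intror (conj L0x L1x)))) U e e0 asym.
by exists T, S, B.
Qed.
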